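(* Let $\alpha\in(-1,0)$. Let $\mu$ be a finite, positive Borel measure on the open upper half plane $\Pi_+$, with compact support in $\overline{\Pi_+}$, such that (i) there exists $c>0$ such that $\mu(R(I))\le c|I|^{1+\alpha}$ for every interval $I\subset\mathbb{R}$; (ii) there does not exist $c>0$ such that $\mu(R(O))\le c\cdot \mathrm{Cap}_{-\alpha/2}(O)$ holds for every open set $O\subset\mathbb{R}$. Let $X:=L^2(\Pi_+,\mu)$ and define $A\in\mathcal{L}(X)$ and $C\in X^*$ by $(Af)(z):=izf(z)$ and $Cf:=\int_{\Pi_+}f(z)\,d\mu(z)$, for $f\in X$, $z\in\Pi_+$. Then $C$ is not $\alpha$-admissible for $A$, but $$\sup_{\lambda\in\mathbb{C}_+}(\mathrm{Re}\,\lambda)^{\frac{1-\alpha}{2}}\|CR(\lambda,A)\|_{X^*}<\infty .$$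
   Context: $\Pi_+=\{z\in\mathbb{C}:\mathrm{Im}\,z>0\}$, $\overline{\Pi_+}=\{z\in\mathbb{C}:\mathrm{Im}\, z\ge 0\}$, $\mathbb{C}_+=\{\lambda\in\mathbb{C}:\mathrm{Re}\,\lambda>0\}$, $R(\lambda,A)=(\lambda-A)^{-1}$. The measure $\mu$ may be regarded as a measure on $\overline{\Pi_+}$ with $\mu(\mathbb{R})=0$; its support (closed in $\overline{\Pi_+}$) is bounded but may meet $\mathbb{R}$. For an interval $I\subset\mathbb{R}$ of length $|I|$, $R(I):=\{x+iy\in\Pi_+: x\in I,\ y\in(0,|I|/2)\}$. For an open set $O\subset\mathbb{R}$ with decomposition $O=\bigcup_i I_i$ into (at most countably many) disjoint open intervals, $R(O):=\bigcup_i R(I_i)$. For $\beta\in(0,1)$ the $\beta$-Riesz capacity of $E\subset\mathbb{R}$ is $\mathrm{Cap}_\beta(E):=\inf\{\|g\|_{L^2(\mathbb{R})}^2: g\in L^2(\mathbb{R}),\ g\ge0,\ I_\beta*g\ge1\text{ on }E\}$, where $I_\beta(x):=|x|^{\beta-1}$. The operator $A$ is bounded and normal and generates the contractive $C_0$-semigroup $(T(t)f)(z)=e^{izt}f(z)$ on $X$. The functional $C$ is called $\alpha$-admissible for $A$ if there exists $M>0$ such that $\int_0^\infty t^\alpha|CT(t)x_0|^2\,dt\le M^2\|x_0\|_X^2$ for all $x_0\in D(A)$ (here $D(A)=X$). *)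

(* Defs.v *)
From HB Require Import structures.
From mathcomp Require Import all_boot all_order all_algebra.
From mathcomp Require Import complex.
From mathcomp Require Import all_classical all_reals all_analysis.
From mathcomp Require Import measurable_realfun ring lra.

Set Implicit Arguments.
Unset Strict Implicit.
Unset Printing Implicit Defensive.

Import Order.TTheory GRing.Theory Num.Theory.
Import numFieldNormedType.Exports.
Import ComplexField.Normc.

Local Open Scope classical_set_scope.
Local Open Scope ring_scope.
Local Open Scope complex_scope.

Section Carleson_boxes.
Context {R : realType}.

(* Borel measures on the complex plane are taken on R * R, whose product
   sigma-algebra is its Borel sigma-algebra; (x, y) stands for x + iy. *)
Definition toC (z : R * R) : R[i] := z.1 +i* z.2.

Definition Pi_plus : set (R * R) := [set z | 0 < complex.Im (toC z)].

Definition C_plus : set R[i] := [set l | 0 < complex.Re l].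

Definition msupport (mu : {measure set (R * R) -> \bar R}) : set (R * R) :=
  [set z | forall U, open U -> U z -> (0 < mu U)%E].

Definition itv_length (I : set R) : \bar R := lebesgue_measure I.

(* The length is extended-real, so that the box over an unbounded interval is
   the whole half-strip above it. *)
Definition box (I : set R) : set (R * R) :=
  [set z | [/\ I z.1, 0 < z.2 & (z.2%:E < 2^-1%:E * itv_length I)%E]].

(* The disjoint open intervals decomposing an open set of reals are its
   connected components. *)
Definition open_box (O : set R) : set (R * R) :=
  \bigcup_(x in O) box (connected_component O x).

(* The value of powR at 0 makes this kernel vanish at 0 for beta < 1; this only
   matters on a null set. *)
Definition riesz_kernel (beta x : R) : R := `|x| `^ (beta - 1).

Definition riesz_potential (beta : R) (g : R -> R) (x : R) : \bar R :=
  (\int[lebesgue_measure]_y (riesz_kernel beta (x - y) * g y)%:E)%E.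

Definition riesz_capacity (beta : R) (E : set R) : \bar R :=
  ereal_inf [set (Lnorm lebesgue_measure 2%:E (EFin \o g) ^+ 2)%E | g in
    [set g : R -> R | [/\ g \in Lfun lebesgue_measure 2%:E,
      forall x, 0 <= g x &
      forall x, E x -> (1 <= riesz_potential beta g x)%E]]].

End Carleson_boxes.

Section complex_L2.
Context {R : realType}.
Implicit Types (f g : R * R -> R[i]).

Definition cexp (w : R[i]) : R[i] :=
  (expR (complex.Re w))%:C * (cos (complex.Im w) +i* sin (complex.Im w)).

Variable mu : {measure set (R * R) -> \bar R}.

Definition L2norm f : \bar R := Lnorm mu 2%:E (fun z => (normc (f z))%:E).

(* Elements of L^2(mu) are represented by functions; equality in L^2(mu) is
   [ae_eq mu setT]. *)
Definition L2 : set (R * R -> R[i]) :=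
  [set f | [/\ measurable_fun setT (fun z => complex.Re (f z)),
     measurable_fun setT (fun z => complex.Im (f z)) & (L2norm f < +oo)%E]].

Definition cintegral (D : set (R * R)) f : R[i] :=
  Rintegral mu D (fun z => complex.Re (f z)) +i*
  Rintegral mu D (fun z => complex.Im (f z)).

Definition dual_norm (F : (R * R -> R[i]) -> R[i]) : \bar R :=
  ereal_sup [set (normc (F f))%:E | f in [set f | L2 f /\ (L2norm f <= 1)%E]].

(* The preimage of f under l - A in L^2(mu), unique up to a.e. equality when l
   is in the resolvent set of A. *)
Definition resolvent (l : R[i]) (A : (R * R -> R[i]) -> (R * R -> R[i])) f :
    R * R -> R[i] :=
  xget 0 [set g | L2 g /\ ae_eq mu setT (fun z => l * g z - A g z) f].

(* [T] is the semigroup generated by the operator for which C is admissible. *)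
Definition admissible (alpha : R) (C : (R * R -> R[i]) -> R[i])
    (T : R -> (R * R -> R[i]) -> (R * R -> R[i])) : Prop :=
  exists2 M : R, 0 < M & forall x0, L2 x0 ->
    (\int[lebesgue_measure]_(t in `[0%R, +oo[)
        (t `^ alpha * normc (C (T t x0)) ^+ 2)%:E
      <= (M ^+ 2)%:E * L2norm x0 ^+ 2)%E.

Definition opA f : R * R -> R[i] := fun z => 'i%C * toC z * f z.

Definition semigroupT (t : R) f : R * R -> R[i] :=
  fun z => cexp ('i%C * toC z * t%:C) * f z.

Definition functionalC f : R[i] := cintegral Pi_plus f.

End complex_L2.

(* [resolvent] is not a junk value in the case at hand: every l in C_plus is in
   the resolvent set of [opA], with resolvent the division by l - iz. *)
Section resolvent_opA.
Context {R : realType}.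
Variable mu : {measure set (R * R) -> \bar R}.
Hypothesis mu_Pi : mu (~` Pi_plus) = 0%E.
Implicit Types (f g : R * R -> R[i]) (l : R[i]).

Lemma measurable_Pi_plus : measurable (@Pi_plus R).
Proof.
have -> : @Pi_plus R = setT `&` snd @^-1` `]0%R, +oo[%classic.
  by apply/seteqP; split => z /=; rewrite /Pi_plus /= in_itv/= andbT => // -[].
exact: (@measurable_snd _ _ R R measurableT).
Qed.

Lemma ae_Pi_plus (P : R * R -> Prop) :
  (forall z, Pi_plus z -> P z) -> {ae mu, forall z, P z}.
Proof.
move=> h; exists (~` Pi_plus); split => //.
  by apply: measurableC; exact: measurable_Pi_plus.
by apply: subsetC => z; exact: h.
Qed.

Lemma L2normE f :
  (L2norm mu f = (\int[mu]_z (normc (f z) ^+ 2)%:E) `^ 2^-1)%E.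
Proof.
rewrite /L2norm unlock; congr (_ `^ _)%E; apply: eq_integral => z _.
have n0 : 0 <= normc (f z) by case: (f z) => a b; rewrite sqrtr_ge0.
by rewrite abse_EFin ger0_norm// poweR_EFin powR_mulrn.
Qed.

Lemma normc_sqr (x : R[i]) :
  normc x ^+ 2 = complex.Re x ^+ 2 + complex.Im x ^+ 2.
Proof. by case: x => a b /=; rewrite sqr_sqrtr// addr_ge0// sqr_ge0. Qed.

Lemma subr_opA l f z : l * f z - opA f z = (l - 'i%C * toC z) * f z.
Proof. by rewrite /opA mulrBl. Qed.

Lemma resolvent_opA_uniq l f g1 g2 : C_plus l ->
  ae_eq mu setT (fun z => l * g1 z - opA g1 z) f ->
  ae_eq mu setT (fun z => l * g2 z - opA g2 z) f -> ae_eq mu setT g1 g2.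
Proof.
move=> l0 h1 h2; have h0 := @ae_Pi_plus (fun z => Pi_plus z) (fun _ => id).
apply: filterS3 h0 h1 h2 => z z0 /(_ I) h1 /(_ I) h2 _.
move: h2; rewrite -h1 !subr_opA => /mulfI -> //.
apply/eqP => /(congr1 (@complex.Re R)); case: l l0 {h1} => a b.
rewrite /C_plus /Pi_plus/= in z0 *.
by move=> a0; rewrite !(mul0r, mul1r, sub0r, opprK) => /eqP; rewrite gt_eqF// addr_gt0.
Qed.

Lemma resolvent_opAP l f : C_plus l -> L2 mu f ->
  L2 mu (resolvent mu l opA f) /\
  ae_eq mu setT
    (fun z => l * resolvent mu l opA f z - opA (resolvent mu l opA f) z) f.
Proof.
move=> l0 [mfr mfi foo]; rewrite /resolvent.
set S := (X in xget _ X); suff [g Sg] : S !=set0.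
  exact: (@xgetPex _ 0 S (ex_intro _ g Sg)).
pose a (z : R * R) := complex.Re l + z.2.
pose b (z : R * R) := complex.Im l - z.1.
pose d (z : R * R) := (a z ^+ 2 + b z ^+ 2) `^ (-1).
pose gr z := (a z * complex.Re (f z) + b z * complex.Im (f z)) * d z.
pose gi z := (a z * complex.Im (f z) - b z * complex.Re (f z)) * d z.
pose g (z : R * R) : R[i] := (if 0 < z.2 then gr z else 0) +i* (if 0 < z.2 then gi z else 0).
have D0 (z : R * R) : 0 < z.2 -> complex.Re l ^+ 2 <= a z ^+ 2 + b z ^+ 2.
  move=> z0; apply: (@le_trans _ _ (a z ^+ 2)); last by rewrite lerDl sqr_ge0.
  by rewrite lerXn2r ?nnegrE ?ltW ?addr_gt0// ltrDl.
have D1 (z : R * R) : 0 < z.2 -> 0 < a z ^+ 2 + b z ^+ 2.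
  by move=> z0; apply: lt_le_trans (D0 z z0); rewrite exprn_gt0.
have dE (z : R * R) : 0 < z.2 -> d z = (a z ^+ 2 + b z ^+ 2)^-1.
  by move=> z0; rewrite /d powR_inv1// ltW// D1.
have mz2 : measurable_fun setT (fun z : R * R => z.2) by exact: measurable_snd.
have mz1 : measurable_fun setT (fun z : R * R => z.1) by exact: measurable_fst.
have ma : measurable_fun setT a by exact: measurable_funD.
have mb : measurable_fun setT b by exact: measurable_funB.
have md : measurable_fun setT d.
  apply: (@measurableT_comp _ _ _ _ _ _ (fun x : R => x `^ (-1)) _ (fun z => a z ^+ 2 + b z ^+ 2)); first exact: measurable_powR.
  by apply: measurable_funD; apply: measurable_funX.
have mt : measurable_fun setT (fun z : R * R => 0 < z.2).
  exact: measurable_fun_ltr.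
have mgr : measurable_fun setT (fun z => complex.Re (g z)).
  apply: measurable_fun_ifT => //; apply: measurable_funM => //.
  by apply: measurable_funD; apply: measurable_funM.
have mgi : measurable_fun setT (fun z => complex.Im (g z)).
  apply: measurable_fun_ifT => //; apply: measurable_funM => //.
  by apply: measurable_funB; apply: measurable_funM.
exists g; split.
  split => //; move: foo; rewrite !L2normE => /lty_poweRy foo.
  have {}foo := foo (invr_neq0 (lt0r_neq0 (ltr0n R 2))).
  apply: poweR_lty.
  pose k := (complex.Re l ^+ 2)^-1.
  have mn h : measurable_fun setT (fun z => complex.Re (h z)) ->
      measurable_fun setT (fun z => complex.Im (h z)) ->
      measurable_fun setT (fun z : R * R => (normc (h z : R[i]) ^+ 2)%:E).
    move=> m1 m2; apply/measurable_EFinP.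
    under eq_fun do rewrite normc_sqr.
    by apply: measurable_funD; apply: measurable_funX.
  apply: (@le_lt_trans _ _ (\int[mu]_z (k%:E * (normc (f z) ^+ 2)%:E)))%E.
    apply: ge0_le_integral => //.
    - by move=> z _; rewrite lee_fin sqr_ge0.
    - exact: mn.
    - by apply: measurable_funeM; exact: mn.
    move=> z _; rewrite -EFinM lee_fin !normc_sqr /g /gr /gi /=.
    case: ifPn => z0.
      rewrite dE// (_ : _ + _ = (a z ^+ 2 + b z ^+ 2)^-1 *
        (complex.Re (f z) ^+ 2 + complex.Im (f z) ^+ 2)); last first.
        by field; rewrite gt_eqF// D1.
      rewrite ler_wpM2r ?addr_ge0 ?sqr_ge0// lef_pV2 ?posrE ?D1 ?D0//.
      by rewrite exprn_gt0.
    by rewrite expr0n/= addr0 mulr_ge0 ?invr_ge0 ?addr_ge0 ?sqr_ge0.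
  rewrite ge0_integralZl//.
  - rewrite lte_mul_pinfty// lee_fin invr_ge0 sqr_ge0//.
  - exact: mn.
  - by move=> z _; rewrite lee_fin sqr_ge0.
  - by rewrite lee_fin invr_ge0 sqr_ge0.
apply: ae_Pi_plus => z z0 _; rewrite subr_opA.
have {}z0 : 0 < z.2 by [].
rewrite /g z0 /gr /gi dE//; have := D1 z z0; rewrite /a /b.
case: (l) => p q /=; case: (f z) => u v /= D.
rewrite /toC; apply/eqP; rewrite eq_complex/=; apply/andP; split; apply/eqP;
  by field; rewrite gt_eqF.
Qed.

End resolvent_opA.

(* Main.v *)
(** Let B be the union of boxes over an open set O.  Testing admissibility on the
    indicator of B controls the integral of t^alpha |\int_B e^{itz} dmu|^2 by mu(B).
    Since t^alpha is, up to a constant, the integral of s^(-alpha-1) e^{-st} over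
    s > 0, computing the Laplace transform in t first turns the left-hand side
    into a positive double integral over B * B that dominates the energy of
    |z - w^*|^(-alpha-1); this replaces the Fourier transform.  A test function g
    for the capacity of O has, by averaging over an interval of length Im z, a
    smoothed Riesz potential bounded below on B; with b = -alpha/2 the composition
    of two smoothed Riesz kernels of order b is of order 2b, so that AM-GM and the
    energy bound give mu(B) <= C |g|^2, contradicting (ii).  The resolvent bound is
    AM-GM and a layer-cake estimate of the integral of |l - iz|^-2, using (i). *)

Require Import Defs.
From HB Require Import structures.
From mathcomp Require Import all_boot all_order all_algebra.
From mathcomp Require Import complex.
From mathcomp Require Import all_classical all_reals all_analysis.
From mathcomp Require Import measurable_realfun ring lra.

Set Implicit Arguments.
Unset Strict Implicit.
Unset Printing Implicit Defensive.

Import Order.TTheory GRing.Theory Num.Theory.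
Import numFieldNormedType.Exports.
Import ComplexField.Normc.

Local Open Scope classical_set_scope.
Local Open Scope ring_scope.

(** In closed form, the integral of t^alpha e^{-ty} cos(tx) over t > 0 is a Gamma factor times the
    real part of (y - ix)^{-1-alpha}. The Laplace transform replaces it by Re 1/(s + y - ix), a
    rational function that is visibly positive, so crude pointwise lower bounds suffice. The
    remaining obstacle is that e^{-ty} cos(tx) changes sign: interchanges are made for 1 + cos,
    where Tonelli applies, and the part due to 1, which is finite, is cancelled. Distances are l^1
    distances, for which the comparisons become linear arithmetic. The height |I|/2 of the boxes is
    what makes averaging possible: on at least one side of Re z an interval of length Im z fits
    inside O, so a lower bound known only on O reaches the points above it. The range -1 < alpha < 0
    means 0 < b < 1/2: b > 0 controls the kernels near their peak, and b < 1/2 makes the product of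
    two of them integrable at infinity. AM-GM carries a free weight: for the capacity it lets the
    energy be absorbed into the finite mass mu(B), for the resolvent it balances two powers of Re
    l. *)

(** * Integrals of powers over intervals and half-lines *)

Section real_integrals.
Context {R : realType}.
Local Notation leb := (@lebesgue_measure R).
Implicit Types (f F : R -> R) (a b d l p q : R).

Lemma ge0_is_derive_FTC2y f F a l :
  (forall x, a <= x -> 0 <= f x) ->
  (forall x, a <= x -> {for x, continuous f}) ->
  (forall x, a <= x -> is_derive x 1 F (f x)) ->
  F x @[x --> +oo] --> l ->
  (\int[leb]_(x in `[a, +oo[) (f x)%:E = (l - F a)%:E)%E.
Proof.
move=> f0 cf dF Fl; rewrite EFinB; apply: ge0_continuous_FTC2y => //.
- apply: continuous_in_subspaceT => x; rewrite inE/= in_itv/= andbT => ax.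
  exact: cf.
- by move=> x /ltW/dF [].
- apply: cvg_at_right_filter; apply: differentiable_continuous.
  by apply/derivable1_diffP; case: (dF a (lexx a)).
- move=> x; rewrite in_itv/= andbT => /ltW/dF [_ <-].
  by rewrite derive1E.
Qed.

Lemma is_derive_FTC2 f F a b : a < b ->
  (forall x, a <= x <= b -> {for x, continuous f}) ->
  (forall x, a <= x <= b -> is_derive x 1 F (f x)) ->
  (\int[leb]_(x in `[a, b]) (f x)%:E = (F b - F a)%:E)%E.
Proof.
move=> ab cf dF; rewrite EFinB; apply: continuous_FTC2 => //.
- apply: continuous_in_subspaceT => x; rewrite inE/= in_itv/= => ax.
  exact: cf.
- have cF x : a <= x <= b -> {for x, continuous F}.
    move=> /dF dFx; apply: differentiable_continuous.
    by apply/derivable1_diffP; case: dFx.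
  split.
  + by move=> x; rewrite in_itv/= => /andP[/ltW ax /ltW xb];
      case: (dF x) => //; rewrite ax xb.
  + by apply: cvg_at_right_filter; apply: cF; rewrite lexx ltW.
  + by apply: cvg_at_left_filter; apply: cF; rewrite lexx ltW.
- move=> x; rewrite in_itv/= => /andP[/ltW ax /ltW xb].
  by case: (dF x) => [|_ <-]; rewrite ?ax ?xb// derive1E.
Qed.

Lemma continuous_powR p x : 0 < x -> {for x, continuous (fun r : R => r `^ p)}.
Proof.
move=> x0; apply: differentiable_continuous; apply/derivable1_diffP.
by case: (is_derive1_powR p x0).
Qed.

Lemma powRN_cvgy q : 0 < q -> x `^ (- q) @[x --> +oo] --> (0 : R).
Proof.
move=> q0; apply/cvgrPdist_lt => e e0.
near=> x.
have x0 : 0 < x by near: x; apply: nbhs_pinfty_gt; exact: num_real.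
rewrite sub0r normrN ger0_norm ?powR_ge0//.
have xe : e `^ (- q^-1) < x by near: x; apply: nbhs_pinfty_gt; exact: num_real.
have : (e `^ (- q^-1)) `^ q < x `^ q.
  by rewrite gt0_ltr_powR// nnegrE ?powR_ge0 ?ltW.
rewrite -powRrM mulNr mulVf ?gt_eqF// powR_inv1 ?ltW// powRN => h.
by rewrite invf_plt ?posrE ?powR_gt0.
Unshelve. all: by end_near. Qed.

Lemma integral_powR_itvy q a : 0 < q -> 0 < a ->
  (\int[leb]_(r in `[a, +oo[) (r `^ (- q - 1))%:E = (a `^ (- q) / q)%:E)%E.
Proof.
move=> q0 a0; have -> : a `^ (- q) / q = 0 - (- q^-1 * a `^ (- q)).
  by rewrite sub0r mulNr opprK mulrC.
apply: (@ge0_is_derive_FTC2y _ (fun r => - q^-1 * r `^ (- q))).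
- by move=> x _; exact: powR_ge0.
- by move=> x ax; apply: continuous_powR; exact: lt_le_trans ax.
- move=> x ax; have x0 : 0 < x by exact: lt_le_trans ax.
  have := is_derive1_powR (- q) x0 => dx.
  apply: is_derive_eq; rewrite /GRing.scale/=.
  by field; rewrite gt_eqF.
- rewrite -(mulr0 (- q^-1)); apply: cvgM; first exact: cvg_cst.
  exact: powRN_cvgy.
Qed.

Lemma integral_powR_itv p a b : 0 < p -> 0 < a -> a < b ->
  (\int[leb]_(r in `[a, b]) (r `^ (p - 1))%:E = ((b `^ p - a `^ p) / p)%:E)%E.
Proof.
move=> p0 a0 ab; rewrite mulrBl 2!(mulrC _ p^-1).
apply: (@is_derive_FTC2 _ (fun r => p^-1 * r `^ p)) => //.
- by move=> x /andP[ax _]; apply: continuous_powR; exact: lt_le_trans ax.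
- move=> x /andP[ax _]; have x0 : 0 < x by exact: lt_le_trans ax.
  have := is_derive1_powR p x0 => dx.
  apply: is_derive_eq; rewrite /GRing.scale/=.
  by field; rewrite gt_eqF.
Qed.

Lemma measurable_powR_EFin p (D : set R) :
  measurable_fun D (fun r : R => (r `^ p)%:E).
Proof.
apply/measurable_EFinP; apply: (measurable_funS measurableT (@subsetT _ D)); exact: measurable_powR.
Qed.

(** For p < 1 the integrand is unbounded near 0, so the interval is exhausted by closed intervals
    away from 0 and the bound passes to the limit by monotone convergence. *)
Lemma integral_powR_itv0_le p b : 0 < p -> 0 < b ->
  (\int[leb]_(r in `]0%R, b]) (r `^ (p - 1))%:E <= (b `^ p / p)%:E)%E.
Proof.
move=> p0 b0.
(* The shift by 2 keeps the left endpoint strictly below [b] already at n = 0, as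
   [integral_powR_itv] requires. *)
pose F n := `[b * n.+2%:R^-1, b]%classic.
have F0 n : 0 < b * n.+2%:R^-1 by rewrite mulr_gt0.
have Fb n : b * n.+2%:R^-1 < b.
  by rewrite gtr_pMr// invf_lt1// ltr1n.
have FE n x : F n x = (b * n.+2%:R^-1 <= x <= b) :> Prop.
  by rewrite /F/= in_itv.
have FS n : F n `<=` F n.+1.
  move=> x; rewrite !FE => /andP[nx xb]; rewrite xb andbT (le_trans _ nx)//.
  by rewrite ler_pM2l// lef_pV2 ?posrE// ler_nat.
have -> : `]0, b]%classic = \bigcup_n F n.
  apply/seteqP; split => [x /=|x [n _]]; rewrite ?FE /= in_itv/=; last first.
    by move=> /andP[nx ->]; rewrite andbT; exact: lt_le_trans nx.
  move=> /andP[x0 xb]; exists (Num.truncn (b / x)) => //; rewrite FE xb andbT.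
  rewrite ler_pdivrMr// mulrC -ler_pdivrMr// ltW//.
  by apply: (lt_trans (Num.Theory.truncnS_gt _)); rewrite ltr_nat.
have /cvg_lim <- // : (\int[leb]_(r in F i) (r `^ (p - 1))%:E @[i --> \oo] -->
    \int[leb]_(r in \bigcup_i F i) (r `^ (p - 1))%:E)%E.
  apply: ge0_nondecreasing_set_cvg_integral => //.
  - by apply/nondecreasing_seqP => n; rewrite subsetEset; exact: FS.
  - by move=> n; exact: measurable_itv.
  - by move=> n; exact: measurable_powR_EFin.
  - by move=> n x _; rewrite lee_fin powR_ge0.
apply: lime_le.
  apply: ereal_nondecreasing_is_cvgn; apply/nondecreasing_seqP => n.
  apply: ge0_subset_integral => //; [exact: measurable_itv..| |].
    exact: measurable_powR_EFin.
  by move=> x _; rewrite lee_fin powR_ge0.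
apply: nearW => n; rewrite integral_powR_itv// lee_fin ler_pM2r ?invr_gt0//.
by rewrite gerBl powR_ge0.
Qed.

End real_integrals.

(** * Tonelli's theorem for iterated integrals over measurable subsets *)

Section tonelli_in.
Local Open Scope ereal_scope.
Context d1 d2 (T1 : measurableType d1) (T2 : measurableType d2) (R : realType).
Variable m1 : {sigma_finite_measure set T1 -> \bar R}.
Variable m2 : {sigma_finite_measure set T2 -> \bar R}.
Variables (D1 : set T1) (D2 : set T2).
Hypotheses (mD1 : measurable D1) (mD2 : measurable D2).
Variable f : T1 * T2 -> \bar R.
Hypotheses (mf : measurable_fun setT f) (f0 : forall z, 0 <= f z).

Let restrX_meas : measurable_fun setT (f \_ (D1 `*` D2)).
Proof.
rewrite -(measurable_restrictT f (measurableX mD1 mD2)).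
exact: measurable_funTS.
Qed.

Let restrX_ge0 z : 0 <= (f \_ (D1 `*` D2)) z.
Proof. by apply: erestrict_ge0 => ? _; exact: f0. Qed.

Let restrXE x y : (f \_ (D1 `*` D2)) (x, y) =
  (if x \in D1 then if y \in D2 then f (x, y) else 0 else 0).
Proof. by rewrite /patch in_setX/=; case: (x \in D1); case: (y \in D2). Qed.

Lemma measurable_integral_snd :
  measurable_fun setT (fun x => \int[m2]_(y in D2) f (x, y)).
Proof.
have mf2 : measurable_fun setT (f \_ (setT `*` D2)).
  rewrite -(measurable_restrictT f (measurableX measurableT mD2)).
  exact: measurable_funTS.
have h : forall z, 0 <= (f \_ (setT `*` D2)) z.
  by move=> z; apply: erestrict_ge0 => ? _; exact: f0.
have := @measurable_fun_fubini_tonelli_F _ _ _ _ _ m2 _ mf2 h; apply: eq_measurable_fun.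
move=> x _; rewrite /fubini_F [RHS]integral_mkcond; apply: eq_integral => y _.
by rewrite /patch in_setX/= in_setT.
Qed.

Lemma tonelli_in :
  \int[m1]_(x in D1) \int[m2]_(y in D2) f (x, y) =
  \int[m2]_(y in D2) \int[m1]_(x in D1) f (x, y).
Proof.
transitivity (\int[m1]_x \int[m2]_y (f \_ (D1 `*` D2)) (x, y)).
  rewrite integral_mkcond; apply: eq_integral => x _; rewrite {1}/patch.
  case: ifPn => xD1.
    rewrite integral_mkcond; apply: eq_integral => y _.
    by rewrite restrXE xD1.
  by rewrite integral0_eq// => y _; rewrite restrXE (negbTE xD1).
transitivity (\int[m2]_y \int[m1]_x (f \_ (D1 `*` D2)) (x, y)).
  exact: (@fubini_tonelli _ _ _ _ _ m1 m2 _ restrX_meas restrX_ge0).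
rewrite [RHS]integral_mkcond; apply: eq_integral => y _; rewrite [in RHS]/patch.
case: ifPn => yD2.
  rewrite [RHS]integral_mkcond; apply: eq_integral => x _.
  by rewrite restrXE yD2.
by rewrite integral0_eq// => x _; rewrite restrXE (negbTE yD2); case: ifP.
Qed.

End tonelli_in.

Section tonelli3.
Local Open Scope ereal_scope.
Context d1 d2 (T1 : measurableType d1) (T2 : measurableType d2) (R : realType).
Variable m1 : {sigma_finite_measure set T1 -> \bar R}.
Variable m2 : {sigma_finite_measure set T2 -> \bar R}.
Variables (D1 : set T1) (D2 : set T2).
Hypotheses (mD1 : measurable D1) (mD2 : measurable D2).
Variable f : (T1 * T2) * T2 -> \bar R.
Hypotheses (mf : measurable_fun setT f) (f0 : forall z, 0 <= f z).

Let inner_ge0 (v : T1 * T2) : 0 <= \int[m2]_(w in D2) f (v, w).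
Proof. by apply: integral_ge0 => w _; exact: f0. Qed.

Lemma measurable_integral2_snd :
  measurable_fun setT (fun x => \int[m2]_(z in D2) \int[m2]_(w in D2) f ((x, z), w)).
Proof.
exact: (@measurable_integral_snd _ _ _ _ _ m2 _ mD2 _
  (measurable_integral_snd m2 mD2 mf f0) inner_ge0).
Qed.

(** Two exchanges move the integral in x inwards, first past z and then past w. *)
Lemma tonelli3 :
  \int[m1]_(x in D1) \int[m2]_(z in D2) \int[m2]_(w in D2) f ((x, z), w) =
  \int[m2]_(z in D2) \int[m2]_(w in D2) \int[m1]_(x in D1) f ((x, z), w).
Proof.
rewrite (@tonelli_in _ _ _ _ _ m1 m2 _ _ mD1 mD2 _
  (measurable_integral_snd m2 mD2 mf f0) inner_ge0).
apply: eq_integral => z _.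
apply: (@tonelli_in _ _ _ _ _ m1 m2 _ _ mD1 mD2 (fun v => f ((v.1, z), v.2))).
- apply: (measurableT_comp mf); apply: measurable_fun_pair => //.
  by apply: measurable_fun_pair => //; exact: measurable_fst.
- by move=> v; exact: f0.
Qed.

End tonelli3.

Lemma ge0_integral2Zl d (T : measurableType d) (R : realType)
    (m : {sigma_finite_measure set T -> \bar R}) (D : set T) (c : R)
    (k : T -> T -> R) : measurable D -> 0 <= c ->
  measurable_fun setT (fun v : T * T => k v.1 v.2) -> (forall z w, 0 <= k z w) ->
  (\int[m]_(z in D) \int[m]_(w in D) (c * k z w)%:E =
   c%:E * \int[m]_(z in D) \int[m]_(w in D) (k z w)%:E)%E.
Proof.
move=> mD c0 mk k0.
have mEk : measurable_fun setT (fun v : T * T => (k v.1 v.2)%:E).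
  exact/measurable_EFinP.
have k0' : forall v : T * T, (0 <= (k v.1 v.2)%:E)%E by move=> v; rewrite lee_fin.
have m1 := measurable_funTS (D := D) (measurable_integral_snd m mD mEk k0').
rewrite -(ge0_integralZl m mD m1)//; last first.
  by move=> z _; apply: integral_ge0 => w _; rewrite lee_fin.
apply: eq_integral => z _.
have m2 : measurable_fun D (fun w => (k z w)%:E).
  by apply: measurable_funTS; exact: (measurableT_comp mEk (measurable_pair1 z)).
under eq_integral do rewrite EFinM.
by rewrite (ge0_integralZl m mD m2)// => w _; rewrite lee_fin.
Qed.

Lemma integral_indicM d (T : measurableType d) (R : realType)
    (m : {measure set T -> \bar R}) (D E : set T) (f : T -> \bar R) :
  (\int[m]_(x in D) (f x * (\1_E x)%:E) = \int[m]_(x in D `&` E) f x)%E.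
Proof.
rewrite integral_mkcondr; apply: eq_integral => x _; rewrite /patch indicE.
by case: ifP; rewrite ?mule1 ?mule0.
Qed.

Lemma measurable_set_ler d (T : measurableType d) (R : realType) (f g : T -> R) :
  measurable_fun setT f -> measurable_fun setT g ->
  measurable [set x | f x <= g x].
Proof.
move=> mf mg; rewrite -[X in measurable X]setTI.
by have := measurable_fun_ler mf mg; apply.
Qed.

(** * Layer-cake bounds for integrals of negative powers *)

Section layer_cake.
Local Open Scope ereal_scope.
Context d (T : measurableType d) (R : realType).
Variable m : {sigma_finite_measure set T -> \bar R}.
Local Notation leb := (@lebesgue_measure R).
Variables (D : set T) (N : T -> R).
Hypotheses (mD : measurable D) (mN : measurable_fun setT N).

Let S : set (T * R) := [set z | (N z.1 <= z.2)%R].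

Let mS : measurable S.
Proof.
apply: measurable_set_ler; last exact: measurable_snd.
exact: (measurableT_comp mN measurable_fst).
Qed.

Let mSr r : measurable [set x | (N x <= r)%R].
Proof. exact: measurable_set_ler. Qed.

(** For N > 0, N^{-q} is the integral of q r^{-q-1} over r >= N; exchanging the integrals leaves the
    measure of the sublevel set at each r. *)
Lemma layer_cake_powRN (q : R) : (0 < q)%R -> (forall x, D x -> (0 < N x)%R) ->
  \int[m]_(x in D) (N x `^ (- q))%:E =
  \int[leb]_(r in `]0%R, +oo[)
     ((q * r `^ (- q - 1))%:E * m (D `&` [set x | (N x <= r)%R])).
Proof.
move=> q0 N0.
pose f (z : T * R) := ((q * z.2 `^ (- q - 1)) * \1_S z)%R%:E.
have mf : measurable_fun setT f.
  apply/measurable_EFinP; apply: measurable_funM.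
    apply: measurable_funM => //.
    by apply: (measurableT_comp (measurable_powR _)); exact: measurable_snd.
  exact: measurable_indic.
have f0 z : 0 <= f z.
  by rewrite lee_fin mulr_ge0 ?mulr_ge0 ?powR_ge0// ?ltW.
have E1 x r : \1_S (x, r) = \1_[set x | (N x <= r)%R] x :> R.
  by rewrite !indicE; congr (_%:R)%R; congr nat_of_bool; apply/idP/idP; rewrite !inE.
have E2 x r : \1_S (x, r) = \1_(`[N x, +oo[) r :> R.
  rewrite !indicE; congr (_%:R)%R; congr nat_of_bool; apply/idP/idP;
  by rewrite !inE/= in_itv/= andbT.
transitivity (\int[m]_(x in D) \int[leb]_(r in `]0%R, +oo[) f (x, r)); last first.
  rewrite tonelli_in//; apply: eq_integral => r _.
  under eq_integral do rewrite /f/= E1 EFinM.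
  rewrite ge0_integralZl//; first last.
  - by rewrite lee_fin mulr_ge0 ?powR_ge0// ltW.
  - by apply/measurable_EFinP; exact: measurable_indic.
  by congr (_ * _); rewrite integral_indic// setIC.
apply: eq_integral => x /[!inE] /N0 Nx0.
under eq_integral do rewrite /f/= E2 EFinM.
rewrite integral_indicM.
rewrite (_ : _ `&` _ = `[N x, +oo[%classic); last first.
  apply/setIidPr => r /=; rewrite !in_itv/= !andbT; exact: lt_le_trans.
under eq_integral do rewrite EFinM.
rewrite ge0_integralZl//; first last.
- by rewrite lee_fin ltW.
- by move=> r _; rewrite lee_fin powR_ge0.
- exact: measurable_powR_EFin.
rewrite integral_powR_itvy// -EFinM; congr EFin.
by rewrite mulrC divfK// gt_eqF.
Qed.

End layer_cake.

(* The integral of a nonnegative function is a supremum over simple functions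
   below it, hence monotone even without measurability. *)
Lemma ge0_integral_mono d (T : measurableType d) (R : realType)
    (m : {measure set T -> \bar R}) (D : set T) (f g : T -> \bar R) :
  (forall x, D x -> 0 <= f x)%E -> (forall x, D x -> f x <= g x)%E ->
  (\int[m]_(x in D) f x <= \int[m]_(x in D) g x)%E.
Proof.
move=> f0 fg; rewrite !ge0_integralE//; last first.
  by move=> x Dx; apply: le_trans (fg x Dx); exact: f0.
apply: le_ereal_sup => _ [h hf <-]; exists h => // x.
by apply: le_trans (hf x) _; rewrite /patch; case: ifPn => // /set_mem/fg.
Qed.

Lemma measurable_scale_powR_EFin (R : realType) (c p : R) (D : set R) :
  measurable_fun D (fun r : R => (c * r `^ p)%:E).
Proof.
apply/measurable_EFinP; apply: measurable_funM => //.
apply: (measurable_funS measurableT (@subsetT _ D)); exact: measurable_powR.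
Qed.

Section negative_powers.
Local Open Scope ereal_scope.
Context d (T : measurableType d) (R : realType).
Variable m : {sigma_finite_measure set T -> \bar R}.
Local Notation leb := (@lebesgue_measure R).
Variables (D : set T) (N : T -> R) (q g K a : R).
Hypotheses (mD : measurable D) (mN : measurable_fun setT N).
Hypotheses (q0 : (0 < q)%R) (K0 : (0 <= K)%R) (a0 : (0 < a)%R).

(** Layers below [a] are empty; above, the layer-cake integrand is at most K q r^{g-q-1}, integrable
    at infinity because g < q. *)
Lemma integral_powRN_ge :
  (g < q)%R -> (forall x, D x -> a <= N x)%R ->
  (forall r, (a <= r)%R ->
    m (D `&` [set x | (N x <= r)%R]) <= (K * r `^ g)%:E) ->
  \int[m]_(x in D) (N x `^ (- q))%:E <= (K * q / (q - g) * a `^ (g - q))%:E.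
Proof.
move=> gq aN mK; rewrite layer_cake_powRN//; last first.
  by move=> x /aN; exact: lt_le_trans.
apply: (@le_trans _ _ (\int[leb]_(r in `]0%R, +oo[)
    ((K * q * r `^ (- (q - g) - 1))%:E * (\1_(`[a, +oo[) r)%:E))).
  apply: ge0_integral_mono => r; rewrite /= in_itv/= andbT => r0.
    by rewrite mule_ge0// lee_fin mulr_ge0 ?powR_ge0// ltW.
  have [ar|ra] := leP a r.
    rewrite indicE mem_set ?mule1; last by rewrite /= in_itv/= ar.
    rewrite (_ : - (q - g) - 1 = - q - 1 + g)%R; last by ring.
    rewrite (@powRD _ r (- q - 1) g); last by rewrite (gt_eqF r0) implybT.
    rewrite (_ : K * q * _ = q * r `^ (- q - 1) * (K * r `^ g))%R; last by ring.
    rewrite [leRHS]EFinM lee_wpmul2l ?mK//.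
    by rewrite lee_fin mulr_ge0 ?powR_ge0// ltW.
  rewrite (_ : _ `&` _ = set0) ?measure0 ?mule0//.
    by rewrite mule_ge0 ?lee_fin// mulr_ge0 ?powR_ge0// mulr_ge0// ltW.
  by apply/seteqP; split => // x [/aN aNx]/= /(le_trans aNx); rewrite leNgt ra.
rewrite integral_indicM (_ : _ `&` _ = `[a, +oo[%classic); last first.
  by apply/setIidPr => r /=; rewrite !in_itv/= !andbT; exact: lt_le_trans.
under eq_integral do rewrite EFinM.
rewrite ge0_integralZl//; first last.
- by rewrite lee_fin mulr_ge0// ltW.
- by move=> r _; rewrite lee_fin powR_ge0.
- exact: measurable_powR_EFin.
rewrite integral_powR_itvy ?subr_gt0// -EFinM lee_fin opprB.
by rewrite mulrA mulrAC.
Qed.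

(** Since q < g, the growth bound is integrable near 0 and is used up to [a]; beyond [a] the total
    mass takes over. The two contributions q / (g - q) and 1 add up to g / (g - q). *)
Lemma integral_powRN_lt :
  (q < g)%R -> (forall x, D x -> 0 < N x)%R -> m D <= (K * a `^ g)%:E ->
  (forall r, (0 < r)%R ->
    m (D `&` [set x | (N x <= r)%R]) <= (K * r `^ g)%:E) ->
  \int[m]_(x in D) (N x `^ (- q))%:E <= (K * g / (g - q) * a `^ (g - q))%:E.
Proof.
move=> qg N0 mDK mK; rewrite layer_cake_powRN//.
have S r : m (D `&` [set x | (N x <= r)%R]) <= m D.
  apply: le_measure; rewrite ?inE//; apply: measurableI => //.
  exact: measurable_set_ler.
apply: (@le_trans _ _ (\int[leb]_(r in `]0%R, +oo[)
   ((K * q * r `^ ((g - q) - 1))%:E * (\1_(`]0%R, a]) r)%:E +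
    (K * q * a `^ g * r `^ (- q - 1))%:E * (\1_(`[a, +oo[) r)%:E))).
  apply: ge0_integral_mono => r; rewrite /= in_itv/= andbT => r0.
    by rewrite mule_ge0// lee_fin mulr_ge0 ?powR_ge0// ltW.
  have [ra|ar] := leP r a.
    rewrite [in leRHS]indicE mem_set ?mule1; last by rewrite /= in_itv/= r0.
    rewrite -[leLHS]adde0 leeD//; last first.
      by rewrite mule_ge0 ?lee_fin// !mulr_ge0 ?powR_ge0// ltW.
    rewrite (_ : g - q - 1 = - q - 1 + g)%R; last by ring.
    rewrite (@powRD _ r (- q - 1) g); last by rewrite (gt_eqF r0) implybT.
    rewrite (_ : K * q * _ = q * r `^ (- q - 1) * (K * r `^ g))%R; last by ring.
    rewrite [leRHS]EFinM lee_wpmul2l ?mK//.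
    by rewrite lee_fin mulr_ge0 ?powR_ge0// ltW.
  rewrite [X in _ <= _ + _ * X%:E]indicE mem_set ?mule1; last first.
    by rewrite /= in_itv/= ltW.
  rewrite -[leLHS]add0e leeD//.
    by rewrite mule_ge0 ?lee_fin// !mulr_ge0 ?powR_ge0// ltW.
  rewrite (_ : K * q * _ * _ = q * r `^ (- q - 1) * (K * a `^ g))%R; last by ring.
  rewrite [leRHS]EFinM lee_wpmul2l ?(le_trans (S r))//.
  by rewrite lee_fin mulr_ge0 ?powR_ge0// ltW.
rewrite ge0_integralD//; first last.
- apply: emeasurable_funM; last by apply/measurable_EFinP; exact: measurable_indic.
  exact: measurable_scale_powR_EFin.
- by move=> r _; rewrite mule_ge0 ?lee_fin// !mulr_ge0 ?powR_ge0// ltW.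
- apply: emeasurable_funM; last by apply/measurable_EFinP; exact: measurable_indic.
  exact: measurable_scale_powR_EFin.
- by move=> r _; rewrite mule_ge0 ?lee_fin// !mulr_ge0 ?powR_ge0// ltW.
rewrite !integral_indicM.
rewrite (_ : `]0%R, +oo[ `&` `]0%R, a] = `]0%R, a]%classic); last first.
  by apply/setIidPr => r /=; rewrite !in_itv/= !andbT => /andP[].
rewrite (_ : `]0%R, +oo[ `&` `[a, +oo[ = `[a, +oo[%classic); last first.
  by apply/setIidPr => r /=; rewrite !in_itv/= !andbT; exact: lt_le_trans.
under eq_integral do rewrite EFinM.
rewrite ge0_integralZl//; first last.
- by rewrite lee_fin mulr_ge0// ltW.
- by move=> r _; rewrite lee_fin powR_ge0.
- exact: measurable_powR_EFin.
under [X in _ + X <= _]eq_integral do rewrite EFinM.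
rewrite ge0_integralZl//; first last.
- by rewrite lee_fin !mulr_ge0 ?powR_ge0// ltW.
- by move=> r _; rewrite lee_fin powR_ge0.
- exact: measurable_powR_EFin.
rewrite integral_powR_itvy//.
apply: (@le_trans _ _ ((K * q)%:E * (a `^ (g - q) / (g - q))%:E +
  (K * q * a `^ g)%:E * (a `^ (- q) / q)%:E)).
  rewrite leeD2r// lee_wpmul2l ?lee_fin ?mulr_ge0//; first exact: ltW.
  by apply: integral_powR_itv0_le => //; rewrite subr_gt0.
rewrite -!EFinM -EFinD lee_fin (@powRD _ a g (- q)); last by rewrite (gt_eqF a0) implybT.
rewrite le_eqVlt; apply/orP; left; apply/eqP; field.
by rewrite !gt_eqF ?subr_gt0.
Qed.

End negative_powers.

(** * Boxes over an open set through rational intervals *)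

Section open_box_description.
Context {R : realType}.
Local Notation leb := (@lebesgue_measure R).
Implicit Types (I O : set R) (x p q h : R).

Lemma itv_length_le I h : 0 <= h ->
  (forall p q, I p -> I q -> q - p <= h) -> (itv_length I <= h%:E)%E.
Proof.
move=> h0 Ih; have [->|/set0P[p0 Ip0]] := eqVneq I set0.
  by rewrite /itv_length measure0 lee_fin.
have hlb q : I q -> lbound I (q - h).
  by move=> Iq p Ip; rewrite lerBlDr -lerBlDl Ih.
have hI : has_inf I by split; [exists p0|exists (p0 - h); exact: hlb].
have IS : I `<=` `[inf I, inf I + h]%classic.
  move=> q Iq /=; rewrite in_itv/= (ge_inf hI.2 Iq)/= -lerBlDr.
  by apply: lb_le_inf; [exact: hI.1|exact: hlb].
apply: (@le_trans _ _ (leb `[inf I, inf I + h]%classic)).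
  exact: le_outer_measure.
rewrite lebesgue_measure_itv/= lte_fin; case: ifPn => _.
  by rewrite -EFinB lee_fin addrC addKr.
by rewrite lee_fin.
Qed.

(** Being under the box height is a strict inequality, so the component can be shrunk to a rational
    interval around [z.1]. This serves both to write the box as a countable union and to find room
    for averaging next to [z.1]. *)
Lemma open_boxP O z : open O -> open_box O z <->
  exists p q : rat, [/\ `](ratr p : R), ratr q[ `<=` O, (ratr p : R) < z.1 < ratr q,
    0 < z.2 & 2 * z.2 < ratr q - ratr p].
Proof.
move=> oO; split => [[x Ox [Ix z2 zI]]|[p [q [pqO zpq z2 pqz]]]]; last first.
  have zO : O z.1 by apply: pqO; rewrite /= in_itv.
  exists z.1 => //; split => //; first exact: connected_component_refl.
  have Isub : `]ratr p, ratr q[%classic `<=` connected_component O z.1.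
    apply: connected_component_max pqO _; first by rewrite /= in_itv.
    by apply/connected_intervalP; exact: interval_is_interval.
  have : (leb `](ratr p : R), ratr q[%classic <= itv_length (connected_component O z.1))%E.
    exact: le_outer_measure.
  have pq : ratr p < ratr q :> R by case/andP: zpq => /lt_trans; apply.
  rewrite lebesgue_measure_itv/= lte_fin pq => h.
  rewrite lte_pdivlMl// -EFinM; apply: (lt_le_trans _ h).
  by rewrite -EFinB lte_fin.
set I := connected_component O x in Ix zI.
have iI : is_interval I by apply/connected_intervalP; exact: component_connected.
have IO : I `<=` O by exact: connected_component_sub.
rewrite lte_pdivlMl// -EFinM in zI.
(* Otherwise all points of the component lie within 2 [z.2] of each other, and so does its
   length. *)
have [u [v [Iu Iv uv]]] : exists u v, [/\ I u, I v & 2 * z.2 < v - u].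
  apply: contrapT => h; move: zI; rewrite ltNge => /negP; apply.
  apply: itv_length_le; first by rewrite mulr_ge0// ltW.
  move=> p q Ip Iq; rewrite leNgt; apply/negP => pq; apply: h.
  by exists p, q.
have [e e0 zeO] : exists2 e : R, 0 < e & ball z.1 e `<=` O.
  have /open_nbhs_nbhs/nbhs_ballP[e /= e0 h] : open_nbhs z.1 O by split => //; exact: IO.
  by exists e.
have zeI : ball z.1 e `<=` I.
  have -> : I = connected_component O z.1 by exact/same_connected_component.
  apply: connected_component_max => //; first exact: ballxx.
  by rewrite ball_itv; apply/connected_intervalP; exact: interval_is_interval.
have e20 : 0 < e / 2 by rewrite divr_gt0.
have Im : I (z.1 - e / 2).
  apply: zeI; rewrite /ball/= opprB addrC subrK gtr0_norm//; lra.
have Ip : I (z.1 + e / 2).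
  apply: zeI; rewrite /ball/= opprD addNKr normrN gtr0_norm//; lra.
(* The points [u] and [v] may lie on the same side of [z.1]; these endpoints stay in the component
   and enclose [z.1] strictly. *)
pose p0 := Num.min u (z.1 - e / 2); pose q0 := Num.max v (z.1 + e / 2).
have Ip0 : I p0 by rewrite /p0; case: leP.
have Iq0 : I q0 by rewrite /q0; case: leP.
have p0z : p0 < z.1 by rewrite /p0 gt_min; apply/orP; right; lra.
have q0z : z.1 < q0 by rewrite /q0 lt_max; apply/orP; right; lra.
have pq0 : 2 * z.2 < q0 - p0.
  have : p0 <= u by rewrite ge_min lexx.
  have : v <= q0 by rewrite le_max lexx.
  lra.
(* Half of the slack: moving each endpoint inwards by less than [d] keeps the length above 2
   [z.2]. *)
pose d := (q0 - p0 - 2 * z.2) / 2.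
have d0 : 0 < d by rewrite divr_gt0// subr_gt0.
have /rat_in_itvoo[p] : p0 < Num.min z.1 (p0 + d) by rewrite lt_min p0z ltrDl.
have /rat_in_itvoo[q] : Num.max z.1 (q0 - d) < q0 by rewrite gt_max q0z gtrBl.
rewrite !in_itv/= gt_max lt_min => /andP[/andP[zq dq] qq0] /andP[pp0 /andP[pz pd]].
exists p, q; split => //.
- move=> t /=; rewrite in_itv/= => /andP[pt tq]; apply: IO; apply: (iI p0 q0) => //.
  by rewrite !ltW// ?(lt_trans pp0)// (lt_trans tq).
- by rewrite pz zq.
- by rewrite /d in dq pd; lra.
Qed.

Lemma measurable_open_box O : open O -> measurable (open_box O).
Proof.
move=> oO.
(* The condition on [O] does not involve [z], so each [W p q] is either a rectangle or empty. *)
pose W (p q : rat) : set (R * R) := [set z | `](ratr p : R), ratr q[ `<=` O] `&`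
  (`]ratr p, ratr q[ `*` `]0, (ratr q - ratr p) / 2[).
have -> : open_box O = \bigcup_p \bigcup_q W p q.
  apply/seteqP; split => [z /(open_boxP _ oO)|z].
    move=> [p [q [pqO zpq z2 pqz]]]; exists p => //; exists q => //; split => //.
    by split; rewrite /= in_itv/= ?zpq// z2 ltr_pdivlMr// mulrC.
  move=> [p _ [q _ [/= pqO]]] [/=]; rewrite !in_itv/= => zpq /andP[z2 zq].
  by apply/(open_boxP _ oO); exists p, q; split => //; rewrite mulrC -ltr_pdivlMr.
apply: bigcupT_measurable_rat => p; apply: bigcupT_measurable_rat => q.
have [pqO|pqO] := pselect (`](ratr p : R), ratr q[ `<=` O).
  rewrite /W (_ : [set _ | _] = setT) ?setTI; last by apply/seteqP; split.
  exact: measurableX.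
rewrite /W (_ : [set _ | _] = set0) ?set0I; last by apply/seteqP; split.
exact: measurable0.
Qed.

Lemma open_box_Pi_plus O z : open_box O z -> 0 < z.2.
Proof. by case=> x _ []. Qed.

End open_box_description.

(** * Smoothed Riesz kernels and their composition *)

Section tent.
Context {R : realType}.
Local Notation leb := (@lebesgue_measure R).
Implicit Types (z w : R * R) (s r b p : R).

(* The l^1-distance from the point z of the upper half plane to the real
   number s, and from z to the conjugate of w. *)
Definition tent z s : R := `|z.1 - s| + z.2.
Definition tent2 z w : R := `|z.1 - w.1| + (z.2 + w.2).

Lemma powR_le_npow p r s : p <= 0 -> 0 < r -> r <= s -> s `^ p <= r `^ p.
Proof.
move=> p0 r0 rs; have s0 : 0 < s by exact: lt_le_trans rs.
rewrite -(opprK p) !(powRN _ (- p)) lef_pV2 ?posrE ?powR_gt0//.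
by rewrite ge0_ler_powR ?oppr_ge0// nnegrE ltW.
Qed.

Lemma tent_gt0 z s : 0 < z.2 -> 0 < tent z s.
Proof. by move=> z0; rewrite ltr_wpDl. Qed.

Lemma tent2_le z w s : tent2 z w <= tent z s + tent w s.
Proof.
rewrite /tent2 /tent; have := ler_distD s z.1 w.1; rewrite (distrC s w.1); lra.
Qed.

Lemma measurable_tent z : measurable_fun setT (tent z).
Proof.
apply: measurable_funD => //; apply: measurableT_comp => //.
exact: measurable_funB.
Qed.

Lemma measurable_tent2 : measurable_fun setT (fun v : (R * R) * (R * R) => tent2 v.1 v.2).
Proof.
apply: measurable_funD.
  apply: measurableT_comp => //; apply: measurable_funB.
    exact: (measurableT_comp measurable_fst measurable_fst).
  exact: (measurableT_comp measurable_fst measurable_snd).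
apply: measurable_funD.
  exact: (measurableT_comp measurable_snd measurable_fst).
exact: (measurableT_comp measurable_snd measurable_snd).
Qed.

Lemma lebesgue_tent_le z r : 0 <= z.2 -> 0 < r ->
  (leb [set s | (tent z s <= r)%R] <= (2 * r)%:E)%E.
Proof.
move=> z0 r0; apply: (@le_trans _ _ (leb `[z.1 - r, z.1 + r]%classic)).
  apply: le_outer_measure => s; rewrite /tent /= in_itv/= => h.
  by rewrite -ler_distlC; lra.
rewrite lebesgue_measure_itv/= lte_fin ifT; last by lra.
by rewrite -EFinB lee_fin; lra.
Qed.

Lemma lebesgue_setI_tent_le z r (D : set R) : measurable D -> 0 <= z.2 -> 0 < r ->
  (leb (D `&` [set s | (tent z s <= r)%R]) <= (2 * r `^ 1)%:E)%E.
Proof.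
move=> mD z0 r0; rewrite powRr1 ?(ltW r0)//; apply: le_trans (lebesgue_tent_le z0 r0).
exact: le_outer_measure.
Qed.

(** The outer 2 counts which of the two tents is the smaller; the summands are the contributions of
    the smaller tent being below and above [tent2]. *)
Definition riesz_comp_cst b :=
  2 * (2^-1 `^ (b - 1) * (2 / b) + 4 * (1 - b) / (1 - 2 * b)).

Lemma riesz_comp_cst_ge0 b : 0 < b < 2^-1 -> 0 <= riesz_comp_cst b.
Proof.
move=> /andP[b0 b12]; rewrite mulr_ge0// addr_ge0// ?mulr_ge0 ?powR_ge0 ?invr_ge0//; lra.
Qed.

(* The larger of the two tents is at least half of tent2, and where the smaller
   one exceeds tent2 it bounds the product by its square. *)
Lemma riesz_composition b z w : 0 < b < 2^-1 -> 0 < z.2 -> 0 < w.2 ->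
  (\int[leb]_s (tent z s `^ (b - 1) * tent w s `^ (b - 1))%:E <=
   (riesz_comp_cst b * tent2 z w `^ (2 * b - 1))%:E)%E.
Proof.
move=> b012 z0 w0; have /andP[b0 b12] := b012.
set D : R := tent2 z w.
have D0 : 0 < D by rewrite /D /tent2 ltr_wpDl// addr_gt0.
have b1 : b - 1 <= 0 by lra.
(* A majorant of the product where [v] has the smaller tent. If that tent is at most D, the other
   one is at least D / 2; if it exceeds D, both factors are bounded by its power b - 1. *)
pose h (v : R * R) s : \bar R :=
  (((D / 2) `^ (b - 1))%:E * (tent v s `^ (- (1 - b)))%:E *
     (\1_[set s | tent v s <= D] s)%:E +
   (tent v s `^ (- (2 - 2 * b)))%:E * (\1_[set s | D <= tent v s] s)%:E)%E.
have h0 v s : (0 <= h v s)%E by rewrite adde_ge0// ?mule_ge0// lee_fin// powR_ge0.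
have mle v : measurable [set s | tent v s <= D].
  exact: measurable_set_ler (measurable_tent v) (measurable_cst _).
have mge v : measurable [set s | D <= tent v s].
  exact: measurable_set_ler (measurable_cst _) (measurable_tent v).
have mp v p : measurable_fun setT (fun s => (tent v s `^ p)%:E).
  apply/measurable_EFinP; apply: (measurableT_comp (measurable_powR p)).
  exact: measurable_tent.
have mh1 v : measurable_fun setT (fun s =>
    (((D / 2) `^ (b - 1))%:E * (tent v s `^ (- (1 - b)))%:E *
     (\1_[set s | tent v s <= D] s)%:E)%E).
  apply: emeasurable_funM; first exact: measurable_funeM.
  by apply/measurable_EFinP; exact: measurable_indic.
have mh2 v : measurable_fun setT (fun s =>
    ((tent v s `^ (- (2 - 2 * b)))%:E * (\1_[set s | D <= tent v s] s)%:E)%E).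
  by apply: emeasurable_funM => //; apply/measurable_EFinP; exact: measurable_indic.
have mh v : measurable_fun setT (h v) by exact: emeasurable_funD.
have hle (v v' : R * R) s : 0 < v.2 -> tent v s <= tent v' s -> D <= tent v s + tent v' s ->
    ((tent v s `^ (b - 1) * tent v' s `^ (b - 1))%:E <= h v s)%E.
  move=> v0 vv' Dvv'; have t0 := tent_gt0 s v0.
  have [tD|Dt] := leP (tent v s) D.
    rewrite /h [in leRHS]indicE mem_set//= mule1 -[leLHS]adde0 leeD//.
      rewrite -EFinM lee_fin opprB mulrC ler_wpM2r ?powR_ge0//.
      by apply: powR_le_npow => //; [rewrite divr_gt0|lra].
    by rewrite mule_ge0// lee_fin// powR_ge0.
  rewrite /h [X in (_ <= _ + _ * X%:E)%E]indicE mem_set//=; last exact: ltW.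
  rewrite mule1 -[leLHS]add0e leeD//.
    by rewrite !mule_ge0// lee_fin// powR_ge0.
  rewrite lee_fin (_ : - (2 - 2 * b) = (b - 1) + (b - 1)); last by ring.
  rewrite (@powRD _ (tent v s) (b - 1) (b - 1)); last by rewrite (gt_eqF t0) implybT.
  by rewrite ler_wpM2l ?powR_ge0//; exact: powR_le_npow.
apply: (@le_trans _ _ (\int[leb]_s (h z s + h w s))%E).
  apply: ge0_integral_mono => s _; first by rewrite lee_fin mulr_ge0 ?powR_ge0.
  have Dzw := tent2_le z w s.
  have [zw|/ltW wz] := leP (tent z s) (tent w s).
    by rewrite -[leLHS]adde0 leeD// hle.
  by rewrite -[leLHS]add0e leeD// mulrC hle// addrC.
rewrite ge0_integralD//; [|exact: mh..].
suff H (v : R * R) : 0 < v.2 -> (\int[leb]_s h v s <=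
    ((2^-1 `^ (b - 1) * (2 / b) + 4 * (1 - b) / (1 - 2 * b)) *
     D `^ (2 * b - 1))%:E)%E.
  apply: le_trans (leeD (H _ z0) (H _ w0)) _.
  by rewrite -EFinD lee_fin /riesz_comp_cst; lra.
move=> v0; rewrite ge0_integralD => [|//|s _||s _|]; last 4 first.
- by rewrite !mule_ge0// lee_fin// powR_ge0.
- exact: mh1.
- by rewrite !mule_ge0// lee_fin// powR_ge0.
- exact: mh2.
under eq_integral do rewrite -muleA.
rewrite ge0_integralZl => [|//||s _|]; last 3 first.
- by apply: emeasurable_funM; [exact: mp|apply/measurable_EFinP; apply: measurable_indic; exact: mle].
- by rewrite mule_ge0// lee_fin// powR_ge0.
- by rewrite lee_fin powR_ge0.
rewrite !integral_indicM !setTI.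
have v0' := ltW v0.
(* The exponent 1 - b is below the dimension 1, so the near part is controlled; the exponent 2 - 2b
   of the far part exceeds 1 because b < 1/2. Sublevel sets of a tent have length at most 2r, whence
   K = 2 and g = 1. *)
have lt_part : (\int[leb]_(s in [set s | (tent v s <= D)%R])
    (tent v s `^ (- (1 - b)))%:E <= (2 * 1 / (1 - (1 - b)) * D `^ (1 - (1 - b)))%:E)%E.
  apply: (@integral_powRN_lt _ _ R leb _ (tent v) (1 - b) 1 2 D);
    rewrite ?powRr1 ?(ltW D0)//;
    [exact: mle|exact: measurable_tent|lra|lra| | |].
  - by move=> s _; exact: tent_gt0.
  - exact: lebesgue_tent_le.
  - by move=> r r0; exact: lebesgue_setI_tent_le.
have ge_part : (\int[leb]_(s in [set s | (D <= tent v s)%R])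
    (tent v s `^ (- (2 - 2 * b)))%:E <=
    (2 * (2 - 2 * b) / (2 - 2 * b - 1) * D `^ (1 - (2 - 2 * b)))%:E)%E.
  apply: (@integral_powRN_ge _ _ R leb _ (tent v) (2 - 2 * b) 1 2 D) => //;
    [exact: mge|exact: measurable_tent|lra|lra|].
  by move=> r Dr; apply: lebesgue_setI_tent_le => //; exact: lt_le_trans Dr.
apply: le_trans (leeD (lee_wpmul2l _ lt_part) ge_part) _.
  by rewrite lee_fin powR_ge0.
rewrite -EFinM -EFinD lee_fin powRM ?invr_ge0 ?(ltW D0)//.
rewrite (_ : 2 * b - 1 = (b - 1) + (1 - (1 - b))); last by ring.
rewrite (@powRD _ D (b - 1)); last by rewrite (gt_eqF D0) implybT.
rewrite (_ : 1 - (2 - 2 * b) = (b - 1) + (1 - (1 - b))); last by ring.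
rewrite (@powRD _ D (b - 1)); last by rewrite (gt_eqF D0) implybT.
rewrite le_eqVlt; apply/orP; left; apply/eqP; field.
by rewrite !gt_eqF//; lra.
Qed.

End tent.

(** * From potentials on an open set to smoothed potentials on its boxes *)

Section riesz_potential_on_boxes.
Context {R : realType}.
Local Notation leb := (@lebesgue_measure R).
Implicit Types (z w : R * R) (s r b p : R).

Lemma riesz_kernel_ge0 b x : 0 <= riesz_kernel b x :> R.
Proof. exact: powR_ge0. Qed.

(** If s is farther than 2 [z.2] from [z.1], then |x - s| is at least a third of the tent throughout
    J. Otherwise the tent is at most 3 [z.2], and the layer-cake bound (2 / b) (3 [z.2])^b on the
    singularity produces the factor 6 / b. *)
Lemma integral_riesz_kernel_near b z s (J : set R) : 0 < b < 1 -> 0 < z.2 ->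
  measurable J -> leb J = z.2%:E -> (forall x, J x -> `|x - z.1| <= z.2) ->
  (\int[leb]_(x in J) (riesz_kernel b (x - s))%:E <=
   (6 / b * z.2 * tent z s `^ (b - 1))%:E)%E.
Proof.
move=> /andP[b0 b1] z0 mJ leJ Jz.
have t0 := tent_gt0 s z0.
have [near|far] := leP `|z.1 - s| (2 * z.2); last first.
  apply: (@le_trans _ _ (\int[leb]_(x in J) (6 / b * tent z s `^ (b - 1))%:E)%E).
    apply: ge0_integral_mono => x Jx; rewrite lee_fin ?riesz_kernel_ge0//.
    have xs : tent z s * 3^-1 <= `|x - s|.
      have := ler_distD x z.1 s; rewrite (distrC z.1 x) => h.
      have := Jz x Jx; rewrite /tent; lra.
    apply: (le_trans (powR_le_npow _ _ xs)); [lra|by rewrite divr_gt0|].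
    rewrite powRM ?(ltW t0)// mulrC ler_wpM2r ?powR_ge0//.
    apply: (@le_trans _ _ (3^-1 `^ (-1))).
      by apply: ger_powR; lra.
    by rewrite powR_inv1// invrK ler_pdivlMr//; lra.
  by rewrite integral_cst// [X in (_ * X <= _)%E]leJ -EFinM lee_fin; lra.
have tz : tent z s <= 3 * z.2 by rewrite /tent; lra.
have z30 : 0 < 3 * z.2 by rewrite mulr_gt0.
(* The layer-cake bound needs a positive distance to s; removing one point does not change the
   integral. *)
pose D := J `\ s.
have mD : measurable D by exact: measurableD.
rewrite (_ : (\int[leb]_(x in J) _)%E =
    (\int[leb]_(x in D) (tent (s, 0) x `^ (- (1 - b)))%:E)%E); last first.
  rewrite -(@integral_setD1 _ _ s)//.
    apply: eq_integral => x _; rewrite /riesz_kernel /tent/= addr0 opprB.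
    by rewrite distrC.
  apply/measurable_EFinP/measurable_funTS.
  apply: (measurableT_comp (measurable_powR _)).
  by apply: measurableT_comp => //; exact: measurable_funB.
apply: (@le_trans _ _ (2 * 1 / (1 - (1 - b)) * (3 * z.2) `^ (1 - (1 - b)))%:E).
  apply: (@integral_powRN_lt _ _ R leb D (tent (s, 0)) (1 - b) 1 2 (3 * z.2)) => //;
    [exact: measurable_tent|lra|lra| | |].
  - by move=> x [_ /= /eqP xs]; rewrite /tent/= addr0 normr_gt0 subr_eq0 eq_sym.
  - rewrite powRr1 ?(ltW z30)//; apply: (@le_trans _ _ (leb J)).
      by apply: le_outer_measure => x [].
    by rewrite leJ lee_fin; lra.
  - by move=> r r0; exact: lebesgue_setI_tent_le.
rewrite lee_fin opprB addrCA subrr addr0.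
have -> : (3 * z.2) `^ b = 3 * z.2 * (3 * z.2) `^ (b - 1).
  by rewrite mulr_powRB1// ltW.
rewrite mulr1 (_ : _ * _ = 6 / b * z.2 * (3 * z.2) `^ (b - 1)); last by lra.
rewrite ler_wpM2l//; first by rewrite !mulr_ge0 ?invr_ge0// ltW.
by apply: powR_le_npow => //; lra.
Qed.

(* Averaging the potential over an interval of length z.2 next to z.1 that is
   contained in O smooths the Riesz kernel at scale z.2. *)
Lemma riesz_potential_open_box b (O : set R) (g : R -> R) z : 0 < b < 1 ->
  open O -> open_box O z -> measurable_fun setT g -> (forall x, 0 <= g x) ->
  (forall x, O x -> 1 <= riesz_potential b g x)%E ->
  (1 <= (6 / b)%:E * \int[leb]_s (tent z s `^ (b - 1) * g s)%:E)%E.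
Proof.
move=> b01 oO Oz mg g0 Og; have /andP[b0 b1] := b01.
have z0 := open_box_Pi_plus Oz.
have /(open_boxP _ oO)[p [q [pqO /andP[pz zq] _ pqz]]] := Oz.
(* The rational interval is longer than 2 [z.2], so it extends at least [z.2] to the right or to the
   left of [z.1]. *)
have [J [mJ leJ Jz JO]] : exists J : set R, [/\ measurable J, leb J = z.2%:E,
    (forall x, J x -> `|x - z.1| <= z.2) & J `<=` O].
  have [h|h] := leP (z.1 + z.2) (ratr q).
    exists `]z.1, (z.1 + z.2)[%classic; split => //.
    - rewrite lebesgue_measure_itv/= lte_fin ltrDl z0 -EFinB.
      by congr EFin; ring.
    - by move=> x /=; rewrite in_itv/= => /andP[zx xz]; rewrite ler_norml; lra.
    - move=> x /=; rewrite in_itv/= => /andP[zx xz]; apply: pqO => /=.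
      by rewrite in_itv/=; lra.
  exists `](z.1 - z.2), z.1[%classic; split => //.
  - rewrite lebesgue_measure_itv/= lte_fin gtrBl z0 -EFinB.
    by congr EFin; ring.
  - by move=> x /=; rewrite in_itv/= => /andP[zx xz]; rewrite ler_norml; lra.
  - move=> x /=; rewrite in_itv/= => /andP[zx xz]; apply: pqO => /=.
    by rewrite in_itv/=; lra.
pose f (v : R * R) := (riesz_kernel b (v.1 - v.2) * g v.2)%:E.
have f0 v : (0 <= f v)%E by rewrite lee_fin mulr_ge0 ?riesz_kernel_ge0.
have mk : measurable_fun setT (fun v : R * R => riesz_kernel b (v.1 - v.2)).
  apply: (measurableT_comp (measurable_powR _)); apply: measurableT_comp => //.
  exact: measurable_funB.
have mf : measurable_fun setT f.
  by apply/measurable_EFinP/measurable_funM => //; apply: measurableT_comp.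
have h1 : (z.2%:E <= \int[leb]_(x in J) \int[leb]_s f (x, s))%E.
  rewrite -leJ -[leLHS]mul1e -integral_cst//.
  by apply: ge0_integral_mono => // x Jx; apply: Og; exact: JO.
have mt : measurable_fun setT (fun s => (tent z s `^ (b - 1) * g s)%:E).
  apply/measurable_EFinP/measurable_funM => //.
  by apply: (measurableT_comp (measurable_powR _)); exact: measurable_tent.
have h2 : (\int[leb]_(x in J) \int[leb]_s f (x, s) <=
    z.2%:E * ((6 / b)%:E * \int[leb]_s (tent z s `^ (b - 1) * g s)%:E))%E.
  rewrite tonelli_in//.
  apply: (@le_trans _ _ (\int[leb]_s
      ((6 / b * z.2)%:E * (tent z s `^ (b - 1) * g s)%:E))%E).
    apply: ge0_integral_mono => s _; first by apply: integral_ge0 => x _; exact: f0.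
    under eq_integral do rewrite /f/= mulrC EFinM.
    rewrite ge0_integralZl => [|//||x _|]; last 3 first.
    - apply/measurable_EFinP/measurable_funTS.
      apply: (measurableT_comp (measurable_powR _)).
      by apply: measurableT_comp => //; exact: measurable_funB.
    - by rewrite lee_fin riesz_kernel_ge0.
    - by rewrite lee_fin.
    apply: (@le_trans _ _ ((g s)%:E * (6 / b * z.2 * tent z s `^ (b - 1))%:E)%E).
      by rewrite lee_wpmul2l ?lee_fin//; exact: integral_riesz_kernel_near.
    by rewrite -!EFinM lee_fin; lra.
  rewrite ge0_integralZl => [|//||s _|]; last 3 first.
  - exact: mt.
  - by rewrite lee_fin mulr_ge0 ?powR_ge0.
  - by rewrite lee_fin !mulr_ge0 ?invr_ge0// ltW.
  by rewrite muleA -EFinM mulrC.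
by move: (le_trans h1 h2); rewrite -{1}[z.2%:E]mule1 lee_pmul2l.
Qed.

End riesz_potential_on_boxes.

(** * From an energy bound to a capacity bound *)

Lemma Lnorm2_sqr d (T : measurableType d) (R : realType)
    (m : {measure set T -> \bar R}) (f : T -> R) :
  (Lnorm m 2%:E (EFin \o f) ^+ 2 = \int[m]_x (f x ^+ 2)%:E)%E.
Proof.
rewrite unlock poweR12_sqrt ?sqr_sqrte//; last 2 first.
- by apply: integral_ge0 => x _; exact: poweR_ge0.
- by apply: integral_ge0 => x _; exact: poweR_ge0.
apply: eq_integral => x _.
by rewrite abse_EFin poweR_EFin powR_mulrn// real_normK// num_real.
Qed.

(** For finite V the difference of the two sides is (a r - V)^2 / a; V is extended-real because it
    will be a potential, and an infinite V makes the right-hand side infinite. *)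
Lemma AMGM_ereal (R : realType) (a r : R) (V : \bar R) : 0 < a -> 0 <= r -> (0 <= V)%E ->
  (r%:E * V + r%:E * V <= a%:E * (r ^+ 2)%:E + a^-1%:E * (V * V))%E.
Proof.
move=> a0 r0; case: V => [v v0|_|//]; last first.
  have -> : (a^-1%:E * (+oo * +oo) = +oo :> \bar R)%E.
    by rewrite mulyy gt0_muley// lte_fin invr_gt0.
  by rewrite addey ?leey// -EFinM.
rewrite -!EFinM -!EFinD lee_fin -subr_ge0.
rewrite (_ : _ - _ = a^-1 * (a * r - v) ^+ 2); last by field; rewrite gt_eqF.
by rewrite mulr_ge0 ?sqr_ge0 ?invr_ge0// ltW.
Qed.

Section capacity_from_energy.
Context {R : realType}.
Local Notation leb := (@lebesgue_measure R).
Variables (mu : {finite_measure set (R * R)%type -> \bar R}) (b E : R) (O : set R).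
Hypotheses (b012 : 0 < b < 2^-1) (E0 : 0 <= E) (oO : open O).
Let B := open_box O.
Hypothesis energy : (\int[mu]_(z in B) \int[mu]_(w in B)
  (tent2 z w `^ (2 * b - 1))%:E <= E%:E * mu B)%E.

Let mB : measurable B. Proof. exact: measurable_open_box. Qed.

Let t (z : R * R) (s : R) := tent z s `^ (b - 1).

Let t0 z s : 0 <= t z s. Proof. exact: powR_ge0. Qed.

Let mt : measurable_fun setT (fun v : (R * R) * R => t v.1 v.2).
Proof.
apply: (measurableT_comp (measurable_powR _)); apply: measurable_funD.
  apply: measurableT_comp => //; apply: measurable_funB => //.
  exact: (measurableT_comp measurable_fst measurable_fst).
exact: (measurableT_comp measurable_snd measurable_fst).
Qed.

(** The smoothed Riesz potential of order b of the restriction of mu to B. *)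
Let V (s : R) : \bar R := (\int[mu]_(z in B) (t z s)%:E)%E.

Let V0 s : (0 <= V s)%E.
Proof. by apply: integral_ge0 => z _; rewrite lee_fin. Qed.

Let mts s : measurable_fun setT (fun z => (t z s)%:E).
Proof.
apply/measurable_EFinP; exact: (measurableT_comp mt (measurable_pair2 _)).
Qed.

(** Writing V^2 as a double integral and integrating in s first leaves the composition of two
    kernels of order b, which is bounded by the energy kernel of order 2b. *)
Lemma energy_potential :
  (\int[leb]_s (V s * V s) <= (riesz_comp_cst b * E)%:E * mu B)%E.
Proof.
have f0 : forall v : (R * (R * R)) * (R * R),
  (0 <= (t v.1.2 v.1.1 * t v.2 v.1.1)%:E)%E by move=> v; rewrite lee_fin mulr_ge0.
have mf : measurable_fun setT (fun v : (R * (R * R)) * (R * R) =>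
    (t v.1.2 v.1.1 * t v.2 v.1.1)%:E).
  apply/measurable_EFinP/measurable_funM.
    apply: (measurableT_comp mt (measurable_fun_pair _ _)).
      exact: (measurableT_comp measurable_snd measurable_fst).
    exact: (measurableT_comp measurable_fst measurable_fst).
  apply: (measurableT_comp mt (measurable_fun_pair measurable_snd _)).
  exact: (measurableT_comp measurable_fst measurable_fst).
have -> : (\int[leb]_s (V s * V s) = \int[leb]_s \int[mu]_(z in B) \int[mu]_(w in B)
    (t z s * t w s)%:E)%E.
  apply: eq_integral => s _; have mtB := measurable_funTS (D := B) (mts s).
  rewrite -(ge0_integralZr mu mB mtB)//; last by move=> z _; rewrite lee_fin.
  apply: eq_integral => z _; rewrite -(ge0_integralZl mu mB mtB) ?lee_fin//.
  by move=> w _; rewrite lee_fin.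
rewrite [leLHS](_ : _ =
    \int[mu]_(z in B) \int[mu]_(w in B) \int[leb]_s (t z s * t w s)%:E)%E; last first.
  exact: (@tonelli3 _ _ _ _ _ leb mu _ _ measurableT mB _ mf f0).
have C0 := riesz_comp_cst_ge0 b012.
apply: (@le_trans _ _ (\int[mu]_(z in B) \int[mu]_(w in B)
   (riesz_comp_cst b * tent2 z w `^ (2 * b - 1))%:E)%E).
  apply: ge0_integral_mono => z Bz.
    apply: integral_ge0 => w _; apply: integral_ge0 => s _.
    by rewrite lee_fin mulr_ge0.
  apply: ge0_integral_mono => w Bw.
    by apply: integral_ge0 => ? _; rewrite lee_fin mulr_ge0.
  by apply: riesz_composition => //;
    [exact: open_box_Pi_plus Bz|exact: open_box_Pi_plus Bw].
rewrite ge0_integral2Zl//; last 2 first.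
- apply: (measurableT_comp (measurable_powR _)); exact: measurable_tent2.
- by move=> z w; exact: powR_ge0.
by rewrite [in leRHS]EFinM -muleA lee_wpmul2l// lee_fin.
Qed.

(** For a test function g, averaging gives mu(B) <= c times the integral of g V. Doubling this and
    applying AM-GM bounds 2 mu(B) by c a |g|^2 + (c K / a) mu(B), and one copy of mu(B) is
    cancelled. *)
Lemma le_riesz_capacity_of_energy :
  (mu B <= (6 / b * (6 / b * (riesz_comp_cst b * E) + 1))%:E * riesz_capacity b O)%E.
Proof.
have /andP[b0 b12] := b012.
have mB_fin : mu B \is a fin_num by exact: fin_num_measure.
set K := riesz_comp_cst b * E.
have K0 : 0 <= K by rewrite mulr_ge0// riesz_comp_cst_ge0.
set c := 6 / b; have c0 : 0 < c by rewrite divr_gt0.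
(* The AM-GM weight: it makes c K / a at most 1, and the added 1 keeps it positive when K = 0. *)
set a := c * K + 1; have a0 : 0 < a by rewrite ltr_wpDl// mulr_ge0// ltW.
rewrite -lee_pdivrMl ?(mulr_gt0 c0 a0)//.
apply: le_ereal_inf_tmp => _ [g [gL g0 gO] <-].
rewrite lee_pdivrMl ?(mulr_gt0 c0 a0)//.
rewrite [X in (_ * X)%E](_ : _ = \int[leb]_s (g s ^+ 2)%:E)%E; last exact: Lnorm2_sqr.
have mg : measurable_fun setT g by have := sub_Lfun_mfun gL; rewrite inE.
have mcc : mu B = (\int[mu]_(z in B) 1)%E by rewrite integral_cst// mul1e.
have mV : measurable_fun setT V.
  apply: (@measurable_integral_snd _ _ _ _ _ mu B mB (fun v => (t v.2 v.1)%:E)).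
    apply/measurable_EFinP.
    exact: (measurableT_comp mt (measurable_fun_pair measurable_snd measurable_fst)).
  by move=> v; rewrite lee_fin.
have mgV : measurable_fun setT (fun s => (g s)%:E * V s)%E.
  by apply: emeasurable_funM => //; exact/measurable_EFinP.
have gV0 s : (0 <= (g s)%:E * V s)%E by rewrite mule_ge0 ?lee_fin.
have h1 : (mu B <= c%:E * \int[leb]_s ((g s)%:E * V s))%E.
  rewrite {1}mcc.
  apply: (@le_trans _ _ (\int[mu]_(z in B) (c%:E * \int[leb]_s (t z s * g s)%:E))%E).
    apply: ge0_integral_mono => // z Bz; apply: riesz_potential_open_box Bz _ _ _ => //.
    by rewrite b0/=; lra.
  have mtg : measurable_fun setT (fun v : (R * R) * R => (t v.1 v.2 * g v.2)%:E).
    by apply/measurable_EFinP/measurable_funM => //; exact: measurableT_comp.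
  have tg0 : forall v : (R * R) * R, (0 <= (t v.1 v.2 * g v.2)%:E)%E.
    by move=> v; rewrite lee_fin mulr_ge0.
  have m1 := measurable_funTS (D := B) (measurable_integral_snd leb measurableT mtg tg0).
  rewrite (ge0_integralZl mu mB m1); last 2 first.
  - by move=> z _; apply: integral_ge0 => s _; exact: (tg0 (z, s)).
  - by rewrite lee_fin ltW.
  rewrite lee_wpmul2l ?lee_fin ?(ltW c0)//.
  rewrite [leLHS](_ : _ = \int[leb]_s \int[mu]_(z in B) (t z s * g s)%:E)%E; last first.
    exact: (@tonelli_in _ _ _ _ _ mu leb _ _ mB measurableT _ mtg tg0).
  apply: ge0_integral_mono => s _.
    by apply: integral_ge0 => z _; rewrite lee_fin mulr_ge0.
  rewrite -(ge0_integralZl mu mB (measurable_funTS (D := B) (mts s))) ?lee_fin//; last first.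
    by move=> z _; rewrite lee_fin.
  by rewrite le_eqVlt; apply/orP; left; apply/eqP; apply: eq_integral => z _;
    rewrite -EFinM mulrC.
(* Adding mu(B) to both sides is reversible because it is finite; this is where the absorption takes
   place. *)
rewrite -(leeD2rE _ _ mB_fin).
apply: le_trans (leeD h1 h1) _; rewrite -ge0_muleDr ?integral_ge0//.
rewrite -ge0_integralD//.
have mg2 : measurable_fun setT (fun s => (g s ^+ 2)%:E).
  by apply/measurable_EFinP; exact: measurable_funX.
have mVV : measurable_fun setT (fun s => V s * V s)%E by exact: emeasurable_funM.
apply: (@le_trans _ _ (c%:E * (a%:E * \int[leb]_s (g s ^+ 2)%:E +
    a^-1%:E * \int[leb]_s (V s * V s)))%E).
  rewrite lee_wpmul2l ?lee_fin ?(ltW c0)//.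
  rewrite -ge0_integralZl; [|exact: measurableT|exact: mg2|
    by move=> s _; rewrite lee_fin sqr_ge0|by rewrite lee_fin ltW].
  rewrite -ge0_integralZl; [|exact: measurableT|exact: mVV|
    by move=> s _; rewrite mule_ge0|by rewrite lee_fin invr_ge0 ltW].
  rewrite -ge0_integralD; [|exact: measurableT| | | |].
  - by apply: ge0_integral_mono => s _; [rewrite adde_ge0|exact: AMGM_ereal].
  - by move=> s _; rewrite mule_ge0// lee_fin ?sqr_ge0// ltW.
  - exact: measurable_funeM.
  - by move=> s _; rewrite mule_ge0 ?mule_ge0 ?lee_fin ?invr_ge0 ?(ltW a0).
  - exact: measurable_funeM.
rewrite ge0_muleDr ?mule_ge0 ?lee_fin ?invr_ge0 ?(ltW a0)//; last 2 first.
- by apply: integral_ge0 => s _; rewrite lee_fin sqr_ge0.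
- by apply: integral_ge0 => s _; rewrite mule_ge0.
rewrite muleA -EFinM leeD2l// muleA -EFinM.
apply: le_trans (lee_wpmul2l _ energy_potential) _.
  by rewrite lee_fin mulr_ge0 ?invr_ge0 ?(ltW a0) ?(ltW c0).
rewrite muleA -EFinM -[leRHS]mul1e lee_wpmul2r//.
rewrite lee_fin -/K (_ : c / a * K = c * K / a); last by ring.
by rewrite ler_pdivrMr// mul1r /a lerDl.
Qed.

End capacity_from_energy.

(** * Laplace transforms in the time variable *)

Section laplace_transforms.
Context {R : realType}.
Local Notation leb := (@lebesgue_measure R).
Implicit Types (a b c s t : R).

Lemma expRN_cvgy s : 0 < s -> expR (- (s * t)) @[t --> +oo] --> (0 : R).
Proof.
move=> s0; apply: (@cvg_comp _ _ _ (fun t => s * t) (fun t => expR (- t)) _ +oo).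
  exact: gt0_cvgMry.
exact: cvgr_expR.
Qed.

Lemma integral_expRN s : 0 < s ->
  (\int[leb]_(t in `]0%R, +oo[) (expR (- (s * t)))%:E = (s^-1)%:E)%E.
Proof.
move=> s0; rewrite integral_itv_obnd_cbnd; last first.
  by apply/measurable_EFinP/measurable_funTS; apply: measurableT_comp => //; apply: measurableT_comp => //.
have -> : s^-1 = 0 - (- s^-1 * expR (- (s * 0))).
  by rewrite mulr0 oppr0 expR0 mulr1 opprK add0r.
apply: (@ge0_is_derive_FTC2y _ _ (fun t => - s^-1 * expR (- (s * t)))).
- by move=> t _; exact: expR_ge0.
- move=> t _; apply: continuous_comp; last exact: continuous_expR.
  by apply: continuousN; apply: cvgM; [exact: cvg_cst|exact: cvg_id].
- move=> t _; apply: is_derive_eq; rewrite /GRing.scale/=.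
  by field; rewrite gt_eqF.
- by rewrite -(mulr0 (- s^-1)); apply: cvgM; [exact: cvg_cst|exact: expRN_cvgy].
Qed.

(** The summand 1 makes the integrand nonnegative, so that the half-line form of the fundamental
    theorem applies. *)
Lemma integral_expRN_cos s b : 0 < s ->
  (\int[leb]_(t in `]0%R, +oo[) (expR (- (s * t)) * (1 + cos (b * t)))%:E =
   (s^-1 + s / (s ^+ 2 + b ^+ 2))%:E)%E.
Proof.
move=> s0; have sb0 : 0 < s ^+ 2 + b ^+ 2 by rewrite ltr_wpDr ?sqr_ge0// exprn_gt0.
have cN t : {for t, continuous (fun t => - (s * t))}.
  by apply: continuousN; apply: cvgM; [exact: cvg_cst|exact: cvg_id].
have cb t : {for t, continuous (fun t => b * t)}.
  by apply: cvgM; [exact: cvg_cst|exact: cvg_id].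
have cf : continuous (fun t => expR (- (s * t)) * (1 + cos (b * t))).
  move=> t; apply: cvgM.
    by apply: continuous_comp; [exact: cN|exact: continuous_expR].
  apply: cvgD; first exact: cvg_cst.
  by apply: continuous_comp; [exact: cb|exact: continuous_cos].
rewrite integral_itv_obnd_cbnd; last first.
  by apply/measurable_EFinP; apply: measurable_funTS; exact: continuous_measurable_fun.
pose k := (s ^+ 2 + b ^+ 2)^-1.
(* The cosine part is the real part of e^{(-s+ib)t} / (-s+ib). *)
pose F t := expR (- (s * t)) * (k * (b * sin (b * t) - s * cos (b * t)) - s^-1).
have -> : s^-1 + s / (s ^+ 2 + b ^+ 2) = 0 - F 0.
  by rewrite /F !mulr0 oppr0 expR0 sin0 cos0 /k; field; rewrite !gt_eqF.
apply: (@ge0_is_derive_FTC2y _ _ F).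
- move=> t _; apply: mulr_ge0; first exact: expR_ge0.
  by have := cos_geN1 (b * t); lra.
- by move=> t _; exact: cf.
- move=> t _; apply: is_derive_eq; rewrite /GRing.scale/= /k.
  by field; rewrite !gt_eqF.
- pose K := k * (`|b| + s) + s^-1.
  have k0 : 0 <= k by rewrite invr_ge0 ltW.
  have FK t : `|F t| <= K * expR (- (s * t)).
    rewrite normrM ger0_norm ?expR_ge0// mulrC ler_wpM2r ?expR_ge0//.
    apply: (le_trans (ler_normB _ _)); rewrite (@ger0_norm _ s^-1) ?invr_ge0 ?(ltW s0)//.
    rewrite lerD2r normrM ger0_norm// ler_wpM2l//.
    apply: (le_trans (ler_normB _ _)); rewrite !normrM (@ger0_norm _ s) ?(ltW s0)//.
    apply: lerD.
      rewrite -[leRHS]mulr1 ler_wpM2l// ler_norml.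
      by rewrite sin_geN1 sin_le1.
    rewrite -[leRHS]mulr1 ler_wpM2l ?(ltW s0)// ler_norml.
    by rewrite cos_geN1 cos_le1.
  have K0 : K * expR (- (s * t)) @[t --> +oo] --> (0 : R).
    by rewrite -(mulr0 K); apply: cvgM; [exact: cvg_cst|exact: expRN_cvgy].
  apply: (squeeze_cvgr _ _ K0); last by rewrite -oppr0; exact: (cvgN K0).
  by apply: nearW => t; rewrite -ler_norml.
Qed.

(** The exact value is Gamma(p) t^{-p}. For an upper bound the integral is split at 1/t, with
    e^{-st} <= 1 before it and e^{-st} <= 1/(st) after it. *)
Lemma integral_powR_expRN_le p t : 0 < p < 1 -> 0 < t ->
  (\int[leb]_(s in `]0%R, +oo[) (s `^ (p - 1) * expR (- (s * t)))%:E <=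
   ((p^-1 + (1 - p)^-1) * t `^ (- p))%:E)%E.
Proof.
move=> /andP[p0 p1] t0; have ti0 : 0 < t^-1 by rewrite invr_gt0.
apply: (@le_trans _ _ (\int[leb]_(s in `]0%R, +oo[)
   ((s `^ (p - 1))%:E * (\1_(`]0%R, t^-1]) s)%:E +
    (t^-1 * s `^ (- (1 - p) - 1))%:E * (\1_(`[t^-1, +oo[) s)%:E))%E).
  apply: ge0_integral_mono => s; rewrite /= in_itv/= andbT => s0.
    by rewrite lee_fin mulr_ge0 ?powR_ge0 ?expR_ge0.
  have [st|ts] := leP s t^-1.
    rewrite [in leRHS]indicE mem_set ?mule1; last by rewrite /= in_itv/= s0.
    rewrite -[leLHS]adde0 leeD//; last first.
      by rewrite mule_ge0 ?lee_fin// !mulr_ge0 ?powR_ge0// ltW.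
    rewrite lee_fin ler_piMr ?powR_ge0// -expR0 ler_expR oppr_le0 mulr_ge0// ltW//.
  rewrite [X in (_ <= _ + _ * X%:E)%E]indicE mem_set ?mule1; last first.
    by rewrite /= in_itv/= ltW.
  rewrite -[leLHS]add0e leeD//.
    by rewrite mule_ge0 ?lee_fin// ?powR_ge0.
  rewrite lee_fin (_ : - (1 - p) - 1 = (p - 1) + (-1)); last by ring.
  rewrite (@powRD _ s (p - 1) (-1)); last by rewrite (gt_eqF s0) implybT.
  rewrite (powR_inv1 (ltW s0)) mulrCA ler_wpM2l ?powR_ge0// -invfM expRN.
  rewrite lef_pV2 ?posrE ?expR_gt0 ?mulr_gt0// mulrC.
  by apply: le_trans (expR_ge1Dx _); rewrite lerDr.
rewrite ge0_integralD => [|//|s _||s _|]; last 4 first.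
- by rewrite mule_ge0 ?lee_fin ?powR_ge0.
- by apply: emeasurable_funM; [exact: measurable_powR_EFin|
    apply/measurable_EFinP; exact: measurable_indic].
- by rewrite mule_ge0 ?lee_fin// mulr_ge0 ?powR_ge0// ltW.
- by apply: emeasurable_funM; [exact: measurable_scale_powR_EFin|
    apply/measurable_EFinP; exact: measurable_indic].
rewrite !integral_indicM.
rewrite (_ : `]0%R, +oo[ `&` `]0%R, t^-1] = `]0%R, t^-1]%classic); last first.
  by apply/setIidPr => r /=; rewrite !in_itv/= !andbT => /andP[].
rewrite (_ : `]0%R, +oo[ `&` `[t^-1, +oo[ = `[t^-1, +oo[%classic); last first.
  by apply/setIidPr => r /=; rewrite !in_itv/= !andbT; exact: lt_le_trans.
under [X in (_ + X <= _)%E]eq_integral do rewrite EFinM.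
rewrite ge0_integralZl => [|//||s _|]; last 3 first.
- exact: measurable_powR_EFin.
- by rewrite lee_fin powR_ge0.
- by rewrite lee_fin ltW.
rewrite integral_powR_itvy ?subr_gt0//.
apply: (@le_trans _ _ ((t^-1 `^ p / p)%:E + t^-1%:E * (t^-1 `^ (- (1 - p)) / (1 - p))%:E)%E).
  by rewrite leeD2r//; exact: integral_powR_itv0_le.
rewrite -EFinM -EFinD lee_fin (_ : - (1 - p) = p - 1); last by ring.
rewrite mulrA (mulr_powRB1 (ltW ti0) p0) -(powR_inv1 (ltW t0)) -powRrM mulN1r.
by rewrite le_eqVlt; apply/orP; left; apply/eqP; ring.
Qed.

End laplace_transforms.

(** * The orbit of an indicator and its double-integral kernels *)

Section linear_combination.
Context d (T : measurableType d) (R : realType).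
Variables (m : {measure set T -> \bar R}) (D : set T) (mD : measurable D).
Variables f1 f2 f3 : T -> R.
Hypotheses (i1 : m.-integrable D (EFin \o f1)) (i2 : m.-integrable D (EFin \o f2))
  (i3 : m.-integrable D (EFin \o f3)).

(** Three terms, because 1 + cos(t(x - x')) separates into 1, a product of cosines and a product of
    sines. *)
Lemma integral_lin3 (k1 k2 k3 : R) :
  (\int[m]_(x in D) (k1 * f1 x + k2 * f2 x + k3 * f3 x)%:E =
   (k1 * \int[m]_(x in D) f1 x + k2 * \int[m]_(x in D) f2 x +
    k3 * \int[m]_(x in D) f3 x)%R%:E)%E.
Proof.
have j (k : R) f : m.-integrable D (EFin \o f) ->
    m.-integrable D (fun x => (k * f x)%:E).
  by move=> /(integrableZl mD k); apply: eq_integrable.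
have e (k : R) f : m.-integrable D (EFin \o f) ->
    (\int[m]_(x in D) (k * f x)%:E = (k * \int[m]_(x in D) f x)%R%:E)%E.
  move=> jf; rewrite EFinM /Rintegral fineK; last exact: integrable_fin_num.
  by rewrite -integralZl.
under eq_integral do rewrite EFinD EFinD.
rewrite integralD//; last 2 first.
- by apply: integrableD; [|exact: j|exact: j].
- exact: j.
rewrite integralD//; [|exact: j|exact: j].
by rewrite !e// !EFinD.
Qed.

End linear_combination.

Section energy.
Context {R : realType}.
Local Notation leb := (@lebesgue_measure R).
Variables (mu : {finite_measure set (R * R)%type -> \bar R}) (B : set (R * R)).
Hypotheses (mB : measurable B) (B0 : forall z, B z -> 0 < z.2).
Implicit Types (s t : R) (z w : R * R).

Definition exp_mass t := \int[mu]_(z in B) expR (- (t * z.2)).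
Definition cos_mass t := \int[mu]_(z in B) (expR (- (t * z.2)) * cos (t * z.1)).
Definition sin_mass t := \int[mu]_(z in B) (expR (- (t * z.2)) * sin (t * z.1)).

(* The square modulus of the integral over B of z |-> exp(itz). *)
Definition orbit_sqr t := cos_mass t ^+ 2 + sin_mass t ^+ 2.

Lemma orbit_sqr_ge0 t : 0 <= orbit_sqr t.
Proof. by rewrite addr_ge0 ?sqr_ge0. Qed.

Let mexp t : measurable_fun setT (fun z : R * R => expR (- (t * z.2))).
Proof.
apply: measurableT_comp => //; apply: measurableT_comp => //.
by apply: measurable_funM => //; exact: measurable_snd.
Qed.

Let mlin t : measurable_fun setT (fun z : R * R => t * z.1).
Proof. by apply: measurable_funM => //; exact: measurable_fst. Qed.

Let mcos : measurable_fun setT (@cos R).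
Proof. exact: continuous_measurable_fun (@continuous_cos R). Qed.

Let msin : measurable_fun setT (@sin R).
Proof. exact: continuous_measurable_fun (@continuous_sin R). Qed.

Let integrable_le1 (f : R * R -> R) : measurable_fun setT f ->
  (forall z, B z -> `|f z| <= 1) -> mu.-integrable B (EFin \o f).
Proof.
move=> mf f1; apply: measurable_bounded_integrable => //.
- by rewrite -ge0_fin_numE// fin_num_measure.
- exact: measurable_funTS.
- exists 1; split; first exact: num_real.
  by move=> x x1 z Bz /=; apply: le_trans (f1 z Bz) (ltW x1).
Qed.

Let exp_le1 t z : 0 <= t -> B z -> expR (- (t * z.2)) <= 1.
Proof.
by move=> t0 /B0 z0; rewrite -expR0 ler_expR oppr_le0 mulr_ge0// ltW.
Qed.

Let iexp t : 0 <= t -> mu.-integrable B (EFin \o (fun z => expR (- (t * z.2)))).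
Proof.
move=> t0; apply: integrable_le1 => // z Bz.
by rewrite ger0_norm ?expR_ge0// exp_le1.
Qed.

Let icos t : 0 <= t ->
  mu.-integrable B (EFin \o (fun z => expR (- (t * z.2)) * cos (t * z.1))).
Proof.
move=> t0; apply: integrable_le1 => [|z Bz].
  by apply: measurable_funM => //; exact: measurableT_comp.
rewrite normrM ger0_norm ?expR_ge0// mulr_ile1 ?expR_ge0 ?exp_le1//.
by rewrite ler_norml cos_geN1 cos_le1.
Qed.

Let isin t : 0 <= t ->
  mu.-integrable B (EFin \o (fun z => expR (- (t * z.2)) * sin (t * z.1))).
Proof.
move=> t0; apply: integrable_le1 => [|z Bz].
  by apply: measurable_funM => //; exact: measurableT_comp.
rewrite normrM ger0_norm ?expR_ge0// mulr_ile1 ?expR_ge0 ?exp_le1//.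
by rewrite ler_norml sin_geN1 sin_le1.
Qed.

Definition exp_kernel t z w := expR (- (t * (z.2 + w.2))).
(** The cosine term alone represents [orbit_sqr] but changes sign; the added [exp_kernel] makes
    Tonelli applicable and contributes the square of [exp_mass]. *)
Definition cos_kernel t z w := exp_kernel t z w * (1 + cos (t * (z.1 - w.1))).

Lemma integral_cos_kernel t : 0 <= t ->
  (\int[mu]_(z in B) \int[mu]_(w in B) (cos_kernel t z w)%:E =
   (exp_mass t ^+ 2 + orbit_sqr t)%:E)%E.
Proof.
move=> t0; have l3 := integral_lin3 mB (iexp t0) (icos t0) (isin t0).
transitivity (\int[mu]_(z in B)
   (exp_mass t * expR (- (t * z.2)) + cos_mass t * (expR (- (t * z.2)) * cos (t * z.1)) +
    sin_mass t * (expR (- (t * z.2)) * sin (t * z.1)))%:E)%E.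
  apply: eq_integral => z _.
  transitivity (\int[mu]_(w in B)
     (expR (- (t * z.2)) * expR (- (t * w.2)) +
      expR (- (t * z.2)) * cos (t * z.1) * (expR (- (t * w.2)) * cos (t * w.1)) +
      expR (- (t * z.2)) * sin (t * z.1) * (expR (- (t * w.2)) * sin (t * w.1)))%:E)%E.
    apply: eq_integral => w _; congr EFin.
    rewrite /cos_kernel /exp_kernel (mulrDr t) opprD expRD (mulrBr t) cosB; ring.
  by rewrite l3; congr EFin; rewrite /exp_mass /cos_mass /sin_mass; ring.
by rewrite l3; congr EFin; rewrite /orbit_sqr /exp_mass /cos_mass /sin_mass; ring.
Qed.

Lemma integral_exp_kernel t : 0 <= t ->
  (\int[mu]_(z in B) \int[mu]_(w in B) (exp_kernel t z w)%:E =
   (exp_mass t ^+ 2)%:E)%E.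
Proof.
move=> t0; have l3 := integral_lin3 mB (iexp t0) (iexp t0) (iexp t0).
(* Padded with zero terms to fit the shape of [integral_lin3]. *)
transitivity (\int[mu]_(z in B) (exp_mass t * expR (- (t * z.2)) +
   0 * expR (- (t * z.2)) + 0 * expR (- (t * z.2)))%:E)%E.
  apply: eq_integral => z _.
  transitivity (\int[mu]_(w in B) (expR (- (t * z.2)) * expR (- (t * w.2)) +
     0 * expR (- (t * w.2)) + 0 * expR (- (t * w.2)))%:E)%E.
    apply: eq_integral => w _; congr EFin.
    rewrite /exp_kernel mulrDr opprD expRD; ring.
  by rewrite l3; congr EFin; rewrite /exp_mass; ring.
by rewrite l3; congr EFin; rewrite /exp_mass; ring.
Qed.

Let mt3 : measurable_fun setT (fun v : (R * (R * R)) * (R * R) => v.1.1).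
Proof. exact: (measurableT_comp measurable_fst measurable_fst). Qed.

Let mz1 : measurable_fun setT (fun v : (R * (R * R)) * (R * R) => v.1.2.1).
Proof.
exact: (measurableT_comp measurable_fst (measurableT_comp measurable_snd measurable_fst)).
Qed.

Let mz2 : measurable_fun setT (fun v : (R * (R * R)) * (R * R) => v.1.2.2).
Proof.
exact: (measurableT_comp measurable_snd (measurableT_comp measurable_snd measurable_fst)).
Qed.

Let mw1 : measurable_fun setT (fun v : (R * (R * R)) * (R * R) => v.2.1).
Proof. exact: (measurableT_comp measurable_fst measurable_snd). Qed.

Let mw2 : measurable_fun setT (fun v : (R * (R * R)) * (R * R) => v.2.2).
Proof. exact: (measurableT_comp measurable_snd measurable_snd). Qed.

Lemma measurable_exp_kernel : measurable_fun setT (fun v : (R * (R * R)) * (R * R) =>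
  exp_kernel v.1.1 v.1.2 v.2).
Proof.
apply: measurableT_comp => //; apply: measurableT_comp => //.
by apply: measurable_funM => //; exact: measurable_funD.
Qed.

Lemma measurable_cos_kernel : measurable_fun setT (fun v : (R * (R * R)) * (R * R) =>
  cos_kernel v.1.1 v.1.2 v.2).
Proof.
apply: measurable_funM; first exact: measurable_exp_kernel.
apply: measurable_funD => //.
by apply: measurableT_comp => //; apply: measurable_funM => //; exact: measurable_funB.
Qed.

Lemma exp_kernel_ge0 t z w : 0 <= exp_kernel t z w.
Proof. exact: expR_ge0. Qed.

Lemma cos_kernel_ge0 t z w : 0 <= cos_kernel t z w.
Proof.
by rewrite mulr_ge0 ?exp_kernel_ge0//; have := cos_geN1 (t * (z.1 - w.1)); lra.
Qed.

Let me2 (D : set R) : measurable_fun D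
  (fun t => \int[mu]_(z in B) \int[mu]_(w in B) (exp_kernel t z w)%:E)%E.
Proof.
apply: measurable_funTS; apply: (@measurable_integral2_snd _ _ _ _ _ mu B mB
  (fun v => (exp_kernel v.1.1 v.1.2 v.2)%:E)).
  by apply/measurable_EFinP; exact: measurable_exp_kernel.
by move=> v; rewrite lee_fin exp_kernel_ge0.
Qed.

Let mc2 (D : set R) : measurable_fun D
  (fun t => \int[mu]_(z in B) \int[mu]_(w in B) (cos_kernel t z w)%:E)%E.
Proof.
apply: measurable_funTS; apply: (@measurable_integral2_snd _ _ _ _ _ mu B mB
  (fun v => (cos_kernel v.1.1 v.1.2 v.2)%:E)).
  by apply/measurable_EFinP; exact: measurable_cos_kernel.
by move=> v; rewrite lee_fin cos_kernel_ge0.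
Qed.

Lemma measurable_exp_mass_sqr : measurable_fun (`]0, +oo[ : set R) (fun t => exp_mass t ^+ 2).
Proof.
apply/measurable_EFinP; have := @me2 `]0, +oo[%classic.
apply: eq_measurable_fun => t; rewrite inE/= in_itv/= andbT => /ltW.
exact: integral_exp_kernel.
Qed.

(** It is the difference of two iterated integrals of nonnegative kernels, each measurable in t by
    Tonelli. *)
Lemma measurable_orbit_sqr : measurable_fun (`]0, +oo[ : set R) orbit_sqr.
Proof.
apply: (@eq_measurable_fun _ _ _ _ _
    (fun t => (exp_mass t ^+ 2 + orbit_sqr t) - exp_mass t ^+ 2)).
  by move=> t _; rewrite addrC addKr.
apply: measurable_funB; last exact: measurable_exp_mass_sqr.
apply/measurable_EFinP; have := @mc2 `]0, +oo[%classic.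
apply: eq_measurable_fun => t; rewrite inE/= in_itv/= andbT => /ltW.
exact: integral_cos_kernel.
Qed.

End energy.

(** * The energy controlled by the weighted orbit integral *)

Section energy_estimate.
Context {R : realType}.
Local Notation leb := (@lebesgue_measure R).
Variables (mu : {finite_measure set (R * R)%type -> \bar R}) (B : set (R * R)).
Hypotheses (mB : measurable B) (B0 : forall z, B z -> 0 < z.2).
Implicit Types (s t p : R) (z w : R * R).
Local Notation orbit := (orbit_sqr mu B).
Local Notation mass := (exp_mass mu B).

(* The real part of 1 / (s - i (z - w^* )) when s, z.2, w.2 > 0; the absolute
   value makes it nonnegative everywhere. *)
Definition laplace_kernel s z w :=
  `|s + (z.2 + w.2)| / ((s + (z.2 + w.2)) ^+ 2 + (z.1 - w.1) ^+ 2).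

Let measurable_fix_fst (t : R) :
  measurable_fun setT (fun v : (R * R) * (R * R) => ((t, v.1), v.2)).
Proof.
apply: measurable_fun_pair; last exact: measurable_snd.
by apply: measurable_fun_pair; [exact: measurable_cst|exact: measurable_fst].
Qed.

Lemma measurable_laplace_kernel :
  measurable_fun setT (fun v : (R * (R * R)) * (R * R) => laplace_kernel v.1.1 v.1.2 v.2).
Proof.
have m1 : measurable_fun setT
    (fun v : (R * (R * R)) * (R * R) => v.1.1 + (v.1.2.2 + v.2.2)).
  apply: measurable_funD; first exact: (measurableT_comp measurable_fst measurable_fst).
  apply: measurable_funD; last exact: (measurableT_comp measurable_snd measurable_snd).
  exact: (measurableT_comp measurable_snd (measurableT_comp measurable_snd measurable_fst)).
have m2 : measurable_fun setT
    (fun v : (R * (R * R)) * (R * R) => v.1.2.1 - v.2.1).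
  apply: measurable_funB; last exact: (measurableT_comp measurable_fst measurable_snd).
  exact: (measurableT_comp measurable_fst (measurableT_comp measurable_snd measurable_fst)).
apply: measurable_funM; first exact: measurableT_comp.
rewrite (_ : (fun v => _) = (fun v : (R * (R * R)) * (R * R) =>
  ((v.1.1 + (v.1.2.2 + v.2.2)) ^+ 2 + (v.1.2.1 - v.2.1) ^+ 2) `^ (-1))).
  apply: (measurableT_comp (measurable_powR _)).
  by apply: measurable_funD; exact: measurable_funX.
by apply/funext => v; rewrite powR_inv1// addr_ge0 ?sqr_ge0.
Qed.

Lemma laplace_kernel_ge0 s z w : 0 <= laplace_kernel s z w.
Proof. by rewrite divr_ge0 ?addr_ge0 ?sqr_ge0. Qed.

(** The transforms of [exp_kernel] and [cos_kernel] are computed under the double integral, and the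
    first is subtracted from the second. *)
Lemma laplace_orbit_sqr s : 0 < s ->
  (\int[mu]_(z in B) \int[mu]_(w in B) (laplace_kernel s z w)%:E =
   \int[leb]_(t in `]0%R, +oo[) (expR (- (s * t)) * orbit t)%:E)%E.
Proof.
move=> s0.
have mH : measurable_fun setT (fun t => expR (- (s * t))).
  by apply: measurableT_comp => //; apply: measurableT_comp => //; exact: measurable_funM.
have mH3 : measurable_fun setT
    (fun v : (R * (R * R)) * (R * R) => expR (- (s * v.1.1))).
  apply: (measurableT_comp mH).
  exact: (measurableT_comp measurable_fst measurable_fst).
(* The common interchange for both kernels; [c] is the double integral of [k] at each time. *)
have swap (k : R -> R * R -> R * R -> R) (c : R -> R) :
    measurable_fun setT (fun v : (R * (R * R)) * (R * R) => k v.1.1 v.1.2 v.2) ->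
    (forall t z w, 0 <= k t z w) ->
    (forall t, (0 < t)%R ->
      \int[mu]_(z in B) \int[mu]_(w in B) (k t z w)%:E = (c t)%:E)%E ->
    (\int[leb]_(t in `]0%R, +oo[) (expR (- (s * t)) * c t)%:E =
     \int[mu]_(z in B) \int[mu]_(w in B)
       \int[leb]_(t in `]0%R, +oo[) (expR (- (s * t)) * k t z w)%:E)%E.
  move=> mk k0 kc.
  have mHk : measurable_fun setT (fun v : (R * (R * R)) * (R * R) =>
      (expR (- (s * v.1.1)) * k v.1.1 v.1.2 v.2)%:E).
    by apply/measurable_EFinP; exact: measurable_funM.
  have Hk0 (v : (R * (R * R)) * (R * R)) :
      (0 <= (expR (- (s * v.1.1)) * k v.1.1 v.1.2 v.2)%:E)%E.
    by rewrite lee_fin mulr_ge0 ?expR_ge0.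
  transitivity (\int[leb]_(t in `]0%R, +oo[) \int[mu]_(z in B) \int[mu]_(w in B)
      (expR (- (s * t)) * k t z w)%:E)%E; last first.
    exact: (@tonelli3 _ _ _ _ _ leb mu _ _ (measurable_itv _) mB _ mHk Hk0).
  apply: eq_integral => t; rewrite inE/= in_itv/= andbT => t0.
  rewrite ge0_integral2Zl ?expR_ge0 ?kc//.
  exact: (measurableT_comp mk (measurable_fix_fst t)).
pose sg z w := s + (z.2 + w.2).
have sg0 z w : B z -> B w -> 0 < sg z w.
  by move=> /B0 z0 /B0 w0; rewrite !addr_gt0.
have swap_exp : (\int[leb]_(t in `]0%R, +oo[) (expR (- (s * t)) * mass t ^+ 2)%:E =
    \int[mu]_(z in B) \int[mu]_(w in B) (sg z w `^ (-1))%:E)%E.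
  rewrite (swap exp_kernel); last 3 first.
  - exact: measurable_exp_kernel.
  - by move=> *; exact: exp_kernel_ge0.
  - by move=> t /ltW; exact: integral_exp_kernel.
  apply: eq_integral => z /[!inE] Bz; apply: eq_integral => w /[!inE] Bw.
  rewrite powR_inv1 ?(ltW (sg0 _ _ Bz Bw))// -integral_expRN ?sg0//; apply: eq_integral => t _.
  by rewrite /exp_kernel -expRD; congr (expR _)%:E; rewrite /sg; ring.
have swap_cos : (\int[leb]_(t in `]0%R, +oo[)
      (expR (- (s * t)) * (mass t ^+ 2 + orbit t))%:E =
    \int[mu]_(z in B) \int[mu]_(w in B)
      (sg z w `^ (-1) + laplace_kernel s z w)%:E)%E.
  rewrite (swap cos_kernel); last 3 first.
  - exact: measurable_cos_kernel.
  - by move=> *; exact: cos_kernel_ge0.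
  - by move=> t /ltW; exact: integral_cos_kernel.
  apply: eq_integral => z /[!inE] Bz; apply: eq_integral => w /[!inE] Bw.
  rewrite /laplace_kernel (gtr0_norm (sg0 _ _ Bz Bw)).
  rewrite powR_inv1 ?(ltW (sg0 _ _ Bz Bw))// -integral_expRN_cos ?sg0//; apply: eq_integral => t _.
  rewrite /cos_kernel /exp_kernel mulrA -expRD (mulrC t (z.1 - w.1)).
  by congr (expR _ * _)%:E; rewrite /sg; ring.
have msg : measurable_fun setT (fun v : (R * R) * (R * R) => sg v.1 v.2 `^ (-1)).
  apply: (measurableT_comp (measurable_powR _)); apply: measurable_funD => //.
  apply: measurable_funD.
    exact: (measurableT_comp measurable_snd measurable_fst).
  exact: (measurableT_comp measurable_snd measurable_snd).
have mlk : measurable_fun setT (fun v : (R * R) * (R * R) => laplace_kernel s v.1 v.2).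
  exact: (measurableT_comp measurable_laplace_kernel (measurable_fix_fst s)).
have split_cos : (\int[mu]_(z in B) \int[mu]_(w in B)
      (sg z w `^ (-1) + laplace_kernel s z w)%:E =
    \int[mu]_(z in B) \int[mu]_(w in B) (sg z w `^ (-1))%:E +
    \int[mu]_(z in B) \int[mu]_(w in B) (laplace_kernel s z w)%:E)%E.
  under eq_integral => z Bz.
    under eq_integral do rewrite EFinD.
    rewrite ge0_integralD//; last 4 first.
    - by move=> w _; rewrite lee_fin powR_ge0.
    - apply/measurable_EFinP; apply: measurable_funTS.
      exact: (measurableT_comp msg (measurable_pair1 z)).
    - by move=> w _; rewrite lee_fin laplace_kernel_ge0.
    - apply/measurable_EFinP; apply: measurable_funTS.
      exact: (measurableT_comp mlk (measurable_pair1 z)).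
    over.
  rewrite ge0_integralD//.
  - by move=> z _; apply: integral_ge0 => w _; rewrite lee_fin powR_ge0.
  - apply: measurable_funTS.
    apply: (@measurable_integral_snd _ _ _ _ _ mu B mB
      (fun v => (sg v.1 v.2 `^ (-1))%:E)).
      exact/measurable_EFinP.
    by move=> v; rewrite lee_fin powR_ge0.
  - by move=> z _; apply: integral_ge0 => w _; rewrite lee_fin laplace_kernel_ge0.
  - apply: measurable_funTS.
    apply: (@measurable_integral_snd _ _ _ _ _ mu B mB
      (fun v => (laplace_kernel s v.1 v.2)%:E)).
      exact/measurable_EFinP.
    by move=> v; rewrite lee_fin laplace_kernel_ge0.
have split_mass : (\int[leb]_(t in `]0%R, +oo[)
      (expR (- (s * t)) * (mass t ^+ 2 + orbit t))%:E =
    \int[leb]_(t in `]0%R, +oo[) (expR (- (s * t)) * mass t ^+ 2)%:E +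
    \int[leb]_(t in `]0%R, +oo[) (expR (- (s * t)) * orbit t)%:E)%E.
  under eq_integral do rewrite mulrDr EFinD.
  have mH' : measurable_fun (`]0, +oo[ : set R) (fun t => expR (- (s * t))).
    exact: measurable_funTS.
  rewrite ge0_integralD//.
  - by move=> t _; rewrite lee_fin mulr_ge0 ?expR_ge0 ?sqr_ge0.
  - apply/measurable_EFinP/measurable_funM => //.
    exact: measurable_exp_mass_sqr.
  - by move=> t _; rewrite lee_fin mulr_ge0 ?expR_ge0 ?orbit_sqr_ge0.
  - apply/measurable_EFinP/measurable_funM => //.
    exact: measurable_orbit_sqr.
(* The cancelled term is at most mu(B)^2 / s, since [sg] exceeds s on B. *)
have I_fin : (\int[mu]_(z in B) \int[mu]_(w in B) (sg z w `^ (-1))%:E)%E \is a fin_num.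
  rewrite ge0_fin_numE; last first.
    by apply: integral_ge0 => z _; apply: integral_ge0 => w _; rewrite lee_fin powR_ge0.
  apply: (@le_lt_trans _ _ (\int[mu]_(z in B) \int[mu]_(w in B) (s^-1)%:E)%E).
    apply: ge0_integral_mono => z Bz.
      by apply: integral_ge0 => w _; rewrite lee_fin powR_ge0.
    apply: ge0_integral_mono => w Bw; first by rewrite lee_fin powR_ge0.
    rewrite lee_fin powR_inv1 ?(ltW (sg0 _ _ Bz Bw))// lef_pV2 ?posrE ?sg0// lerDl addr_ge0//.
      exact/ltW/B0.
    exact/ltW/B0.
  have mBf : mu B \is a fin_num by exact: fin_num_measure.
  under eq_integral do rewrite integral_cst//=.
  by rewrite integral_cst// ltey_eq !fin_numM.
have I_eq := swap_cos; rewrite split_cos split_mass swap_exp in I_eq.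
by apply/eqP; rewrite eq_le; apply/andP; split; rewrite -(leeD2lE _ _ I_fin) I_eq.
Qed.

(** By positivity it is enough to keep s in [D, 2D]. There s^{p-1} is at least D^{p-1} / 2 and the
    kernel at least D / (9 D^2 + D^2), over an interval of length D; hence 1/20. *)
Lemma laplace_kernel_integral_ge p z w : 0 < p < 1 -> 0 < z.2 -> 0 < w.2 ->
  ((tent2 z w `^ (p - 1) / 20)%:E <=
   \int[leb]_(s in `]0%R, +oo[) (s `^ (p - 1) * laplace_kernel s z w)%:E)%E.
Proof.
move=> /andP[p0 p1] z0 w0; set D := tent2 z w.
have D0 : 0 < D by rewrite /D /tent2 ltr_wpDl// addr_gt0.
pose c := D `^ (p - 1) / (20 * D).
apply: (@le_trans _ _ (\int[leb]_(s in `]0%R, +oo[)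
  (c%:E * (\1_(`[D, 2 * D]) s)%:E))%E).
  rewrite integral_indicM (_ : `]0%R, +oo[ `&` _ = `[D, 2 * D]%classic); last first.
    by apply/setIidPr => s /=; rewrite !in_itv/= andbT => /andP[Ds _]; exact: lt_le_trans Ds.
  rewrite integral_cst//= lebesgue_measure_itv/= lte_fin ifT; last by lra.
  rewrite -EFinB -EFinM lee_fin (_ : c * _ = c * D); last by ring.
  by rewrite le_eqVlt; apply/orP; left; apply/eqP; rewrite /c; field; rewrite gt_eqF.
apply: ge0_integral_mono => s; rewrite /= in_itv/= andbT => s0.
  by rewrite mule_ge0// lee_fin divr_ge0 ?powR_ge0// mulr_ge0// ltW.
have L0 := laplace_kernel_ge0 s z w.
rewrite -EFinM lee_fin indicE.
have [/set_mem|_] := boolP (s \in _); last by rewrite mulr0 mulr_ge0 ?powR_ge0.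
rewrite /= in_itv/= mulr1 => /andP[Ds sD].
have mD : z.2 + w.2 <= D by rewrite /D /tent2 lerDr.
have bD : `|z.1 - w.1| <= D by rewrite /D /tent2 lerDl addr_ge0// ltW.
have m0 : 0 < z.2 + w.2 by rewrite addr_gt0.
have b2 : (z.1 - w.1) ^+ 2 <= D ^+ 2.
  by rewrite -real_normK ?num_real// ler_pXn2r// nnegrE ltW.
have s2 : (s + (z.2 + w.2)) ^+ 2 <= 9 * D ^+ 2.
  have -> : 9 * D ^+ 2 = (3 * D) ^+ 2 by ring.
  by rewrite ler_pXn2r ?nnegrE//; lra.
have sp : 2^-1 * D `^ (p - 1) <= s `^ (p - 1).
  apply: (@le_trans _ _ ((2 * D) `^ (p - 1))); last by apply: powR_le_npow => //; lra.
  rewrite powRM ?(ltW D0)// ler_wpM2r ?powR_ge0//.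
  rewrite -[leLHS](powR_inv1 (ler0n _ 2)) ler_powR ?ler1n//; lra.
have Lk : (10 * D)^-1 <= laplace_kernel s z w.
  have q0 : 0 < (s + (z.2 + w.2)) ^+ 2 + (z.1 - w.1) ^+ 2.
    by rewrite ltr_wpDr ?sqr_ge0// exprn_gt0// addr_gt0.
  rewrite /laplace_kernel ger0_norm; last by rewrite addr_ge0 ?ltW.
  rewrite ler_pdivlMr// mulrC ler_pdivrMr ?mulr_gt0//.
  apply: (@le_trans _ _ (10 * D ^+ 2)); first by lra.
  rewrite (_ : 10 * D ^+ 2 = D * (10 * D)); last by ring.
  by rewrite ler_wpM2r ?mulr_ge0 ?(ltW D0)//; lra.
apply: le_trans (ler_pM _ _ sp Lk); last 2 first.
- by rewrite mulr_ge0 ?powR_ge0.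
- by rewrite invr_ge0 mulr_ge0// ltW.
rewrite le_eqVlt; apply/orP; left; apply/eqP; rewrite /c; field.
by rewrite gt_eqF.
Qed.

(** The power of [tent2] is replaced by an integral in s of Laplace kernels, these by Laplace
    transforms of the orbit, and integrating in s first restores the weight t^{-p}. Every integrand
    is nonnegative. *)
Lemma energy_le p (K : \bar R) : 0 < p < 1 ->
  (\int[leb]_(t in `]0%R, +oo[) (t `^ (- p) * orbit t)%:E <= K)%E ->
  (\int[mu]_(z in B) \int[mu]_(w in B) (tent2 z w `^ (p - 1))%:E <=
   (20 * (p^-1 + (1 - p)^-1))%:E * K)%E.
Proof.
move=> p01; have /andP[p0 p1] := p01 => orbitK.
have mtent : measurable_fun setT (fun v : (R * R) * (R * R) => tent2 v.1 v.2 `^ (p - 1)).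
  exact: (measurableT_comp (measurable_powR _) measurable_tent2).
have -> : (\int[mu]_(z in B) \int[mu]_(w in B) (tent2 z w `^ (p - 1))%:E =
    20%:E * \int[mu]_(z in B) \int[mu]_(w in B) (20^-1 * tent2 z w `^ (p - 1))%:E)%E.
  rewrite ge0_integral2Zl//; last by move=> *; exact: powR_ge0.
  by rewrite muleA -EFinM divff ?mul1e.
rewrite EFinM -muleA lee_wpmul2l//.
(* Extension by zero: measurability of the orbit is known for t > 0 only, whereas Tonelli asks for
   it everywhere. *)
pose o := orbit \_ `]0, +oo[.
have mo : measurable_fun setT o.
  by apply/(measurable_restrictT _ _).1 => //; exact: measurable_orbit_sqr.
have o0 t : 0 <= o t by rewrite /o patchE; case: ifP => // _; exact: orbit_sqr_ge0.
have oE t : 0 < t -> o t = orbit t.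
  by move=> t0; rewrite /o patchE mem_set//= in_itv/= t0.
have mf3 : measurable_fun setT (fun v : (R * (R * R)) * (R * R) =>
    (v.1.1 `^ (p - 1) * laplace_kernel v.1.1 v.1.2 v.2)%:E).
  apply/measurable_EFinP/measurable_funM; last exact: measurable_laplace_kernel.
  apply: (measurableT_comp (measurable_powR _)).
  exact: (measurableT_comp measurable_fst measurable_fst).
have f30 (v : (R * (R * R)) * (R * R)) :
    (0 <= (v.1.1 `^ (p - 1) * laplace_kernel v.1.1 v.1.2 v.2)%:E)%E.
  by rewrite lee_fin mulr_ge0 ?powR_ge0 ?laplace_kernel_ge0.
apply: (@le_trans _ _ (\int[mu]_(z in B) \int[mu]_(w in B)
    \int[leb]_(s in `]0%R, +oo[) (s `^ (p - 1) * laplace_kernel s z w)%:E)%E).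
  apply: ge0_integral_mono => z Bz.
    by apply: integral_ge0 => w _; rewrite lee_fin mulr_ge0 ?powR_ge0.
  apply: ge0_integral_mono => w Bw; first by rewrite lee_fin mulr_ge0 ?powR_ge0.
  by rewrite mulrC; apply: laplace_kernel_integral_ge => //; exact: B0.
rewrite [leLHS](_ : _ = \int[leb]_(s in `]0%R, +oo[) \int[mu]_(z in B)
    \int[mu]_(w in B) (s `^ (p - 1) * laplace_kernel s z w)%:E)%E; last first.
  apply/esym.
  exact: (@tonelli3 _ _ _ _ _ leb mu _ _ (measurable_itv _) mB _ mf3 f30).
rewrite [leLHS](_ : _ = \int[leb]_(s in `]0%R, +oo[) \int[leb]_(t in `]0%R, +oo[)
    (s `^ (p - 1) * expR (- (s * t)) * o t)%:E)%E; last first.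
  apply: eq_integral => s; rewrite inE/= in_itv/= andbT => s0.
  rewrite ge0_integral2Zl ?powR_ge0//; last 2 first.
  - exact: (measurableT_comp measurable_laplace_kernel (measurable_fix_fst s)).
  - by move=> *; exact: laplace_kernel_ge0.
  rewrite laplace_orbit_sqr// -ge0_integralZl//; last 3 first.
  - apply/measurable_EFinP/measurable_funM; last exact: measurable_orbit_sqr.
    apply: measurable_funTS; apply: measurableT_comp => //.
    by apply: measurableT_comp => //; exact: measurable_funM.
  - by move=> t _; rewrite lee_fin mulr_ge0 ?expR_ge0 ?orbit_sqr_ge0.
  - by rewrite lee_fin powR_ge0.
  apply: eq_integral => t; rewrite inE/= in_itv/= andbT => t0.
  by rewrite -EFinM mulrA oE.
have mf2 : measurable_fun setT (fun v : R * R =>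
    (v.1 `^ (p - 1) * expR (- (v.1 * v.2)) * o v.2)%:E).
  apply/measurable_EFinP/measurable_funM; last exact: (measurableT_comp mo measurable_snd).
  apply: measurable_funM.
    exact: (measurableT_comp (measurable_powR _) measurable_fst).
  apply: measurableT_comp => //; apply: measurableT_comp => //.
  exact: measurable_funM.
rewrite [leLHS](_ : _ = \int[leb]_(t in `]0%R, +oo[) \int[leb]_(s in `]0%R, +oo[)
    (s `^ (p - 1) * expR (- (s * t)) * o t)%:E)%E; last first.
  apply: (@tonelli_in _ _ _ _ _ leb leb _ _ (measurable_itv _) (measurable_itv _) _ mf2).
  by move=> v; rewrite lee_fin !mulr_ge0 ?powR_ge0 ?expR_ge0.
set c := p^-1 + (1 - p)^-1.
have c0 : 0 <= c by rewrite addr_ge0 ?invr_ge0 ?subr_ge0// ltW.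
apply: (@le_trans _ _ (\int[leb]_(t in `]0%R, +oo[) (c%:E * (t `^ (- p) * orbit t)%:E))%E).
  apply: ge0_integral_mono => t; rewrite /= in_itv/= andbT => t0.
    by apply: integral_ge0 => s _; rewrite lee_fin !mulr_ge0 ?powR_ge0 ?expR_ge0.
  rewrite oE//; under eq_integral do rewrite mulrC EFinM.
  rewrite ge0_integralZl//; last 3 first.
  - apply/measurable_EFinP/measurable_funTS/measurable_funM.
      exact: measurable_powR.
    apply: measurableT_comp => //; apply: measurableT_comp => //.
    exact: measurable_funM.
  - by move=> s _; rewrite lee_fin mulr_ge0 ?powR_ge0 ?expR_ge0.
  - by rewrite lee_fin orbit_sqr_ge0.
  rewrite -EFinM mulrA mulrC EFinM lee_wpmul2l ?lee_fin ?orbit_sqr_ge0//.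
  exact: integral_powR_expRN_le.
rewrite ge0_integralZl//; last 2 first.
- apply/measurable_EFinP/measurable_funM; last exact: measurable_orbit_sqr.
  apply: measurable_funTS; exact: measurable_powR.
- by move=> t _; rewrite lee_fin mulr_ge0 ?powR_ge0 ?orbit_sqr_ge0.
by rewrite lee_wpmul2l.
Qed.

End energy_estimate.

(** * Admissibility forces the capacity inequality *)

Lemma not_admissible_of_capacity (R : realType) (alpha : R)
    (mu : {finite_measure set (R * R)%type -> \bar R}) :
  -1 < alpha < 0 -> mu (~` Pi_plus) = 0%E ->
  admissible mu alpha (functionalC mu) semigroupT ->
  exists2 c : R, 0 < c & forall O : set R, open O ->
    (mu (open_box O) <= c%:E * riesz_capacity (- alpha / 2) O)%E.
Proof.
move=> /andP[alpha1 alpha0] hmu [M M0 adm].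
(* The constant of [energy_le] at p = -alpha, times the admissibility constant; it is the same for
   every O. *)
pose E := 20 * ((- alpha)^-1 + (1 - - alpha)^-1) * M ^+ 2.
have E0 : 0 <= E.
  apply: mulr_ge0; last exact: sqr_ge0.
  by apply: mulr_ge0 => //; apply: addr_ge0; rewrite invr_ge0; lra.
have b012 : 0 < - alpha / 2 < 2^-1 by lra.
have K0 := riesz_comp_cst_ge0 b012.
have b60 : 0 < 6 / (- alpha / 2) :> R by rewrite divr_gt0//; lra.
exists (6 / (- alpha / 2) * (6 / (- alpha / 2) * (riesz_comp_cst (- alpha / 2) * E) + 1)).
  by rewrite mulr_gt0// ltr_wpDl// mulr_ge0 ?(ltW b60)// mulr_ge0.
move=> O oO; apply: le_riesz_capacity_of_energy => //.
set B := open_box O.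
have mB : measurable B by exact: measurable_open_box.
have B0 z : B z -> 0 < z.2 by exact: open_box_Pi_plus.
pose f (z : R * R) : R[i] := (\1_B z)%:C%C.
have f_sqr z : normc (f z) ^+ 2 = \1_B z.
  rewrite normc_sqr /f/= indicE; case: (_ \in _); rewrite /=; ring.
(* An indicator equals its own square, which makes the right-hand side of admissibility linear in
   mu(B), as the absorption argument needs. *)
have normf : (L2norm mu f ^+ 2 = mu B)%E.
  rewrite [LHS](Lnorm2_sqr mu (fun z => normc (f z))).
  by under eq_integral do rewrite f_sqr; rewrite integral_indic// setIT.
have L2f : L2 mu f.
  split => //; first exact: measurable_indic.
  rewrite L2normE; apply: poweR_lty.
  under eq_integral do rewrite f_sqr.
  by rewrite integral_indic// setIT -ge0_fin_numE// fin_num_measure.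
have orbitE t : normc (functionalC mu (semigroupT t f)) ^+ 2 = orbit_sqr mu B t.
  have PB : Pi_plus `&` B = B.
    by apply/setIidPr => z /B0.
  have int_B (h : R * R -> R) : Rintegral mu Pi_plus (fun z => h z * \1_B z) =
      Rintegral mu B h.
    rewrite /Rintegral; under eq_integral do rewrite EFinM.
    by rewrite integral_indicM PB.
  rewrite /functionalC /cintegral normc_sqr [LHS]/= /orbit_sqr /cos_mass /sin_mass -!int_B.
  have reE (z : R * R) : (0 * z.1 - 1 * z.2) * t - (0 * z.2 + 1 * z.1) * 0 = - (t * z.2).
    by ring.
  have imE (z : R * R) : (0 * z.1 - 1 * z.2) * 0 + (0 * z.2 + 1 * z.1) * t = t * z.1.
    by ring.
  by congr (_ ^+ 2 + _ ^+ 2); congr Rintegral; apply/funext => z; rewrite reE imE; ring.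
have := adm f L2f; rewrite normf.
under eq_integral do rewrite orbitE.
(* The endpoint t = 0 is dropped, since the energy estimate integrates over t > 0. *)
rewrite -integral_itv_obnd_cbnd; last first.
  apply/measurable_EFinP/measurable_funM; last exact: measurable_orbit_sqr.
  apply: measurable_funTS; exact: measurable_powR.
rewrite -{1}(opprK alpha) => h.
have /(energy_le mB B0)/(_ h) : 0 < - alpha < 1 by lra.
rewrite (_ : 2 * (- alpha / 2) - 1 = - alpha - 1); last by lra.
by rewrite muleA -EFinM.
Qed.

(** * The resolvent estimate from the Carleson condition *)

Section resolvent_bound.
Context {R : realType}.
Variables (alpha c : R) (mu : {finite_measure set (R * R)%type -> \bar R}).
Hypotheses (halpha : -1 < alpha < 0) (hmu : mu (~` Pi_plus) = 0%E) (c0 : 0 < c).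
Hypothesis carleson : forall I : set R, is_interval I ->
  (mu (box I) <= c%:E * itv_length I `^ (1 + alpha))%E.
Variable l : R[i].
Hypothesis l0 : C_plus l.
Let a := complex.Re l.
(** The l^1 size of l - iz, whose real part is a + [z.2] and whose imaginary part is Im l -
    [z.1]. *)
Let N (z : R * R) := a + tent z (complex.Im l).

Let a0 : 0 < a. Proof. exact: l0. Qed.

Let mN : measurable_fun setT N.
Proof.
apply: measurable_funD => //; apply: measurable_funD; last exact: measurable_snd.
by apply: measurableT_comp => //; apply: measurable_funB => //; exact: measurable_fst.
Qed.

(** The constant of [integral_powRN_ge] for q = 2, g = 1 + alpha and growth constant c
    2^{1+alpha}. *)
Let K := c * 2 `^ (1 + alpha) * 2 / (2 - (1 + alpha)).

(** The set where N <= r lies in the box over the interval of radius r about Im l, whose height is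
    exactly r; the positive summand [a] makes the inclusions strict. The Carleson condition then
    gives growth of order 1 + alpha < 2. *)
Lemma integral_resolvent_kernel :
  (\int[mu]_(z in Pi_plus) (N z `^ (- 2))%:E <= (K * a `^ (alpha - 1))%:E)%E.
Proof.
have /andP[alpha1 alpha0] := halpha.
rewrite (_ : alpha - 1 = 1 + alpha - 2); last by ring.
apply: integral_powRN_ge => //.
- exact: measurable_Pi_plus.
- by rewrite mulr_ge0 ?powR_ge0// ltW.
- lra.
- move=> z; rewrite /Pi_plus/= => z0; rewrite /N lerDl; exact/ltW/tent_gt0.
move=> r ar; have r0 : 0 < r by exact: lt_le_trans ar.
pose I := `](complex.Im l - r), (complex.Im l + r)[%classic.
have lI : itv_length I = (2 * r)%:E.
  rewrite /itv_length lebesgue_measure_itv/= lte_fin ifT; last by lra.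
  by rewrite -EFinB; congr EFin; ring.
have boxE : box I = I `*` `]0, r[%classic.
  have h2 : (2^-1%:E * itv_length I = r%:E)%E by rewrite lI -EFinM mulKf.
  apply/seteqP; split => [z [Iz z0]|z [Iz]]; rewrite /= ?in_itv/= ?h2 ?lte_fin.
    by move=> ->; rewrite z0.
  by move=> /andP[z0 zr]; split => //; rewrite h2 lte_fin.
apply: (@le_trans _ _ (mu (box I))).
  apply: le_measure; rewrite ?inE.
  - apply: measurableI; first exact: measurable_Pi_plus.
    exact: (measurable_set_ler mN (measurable_cst r)).
  - by rewrite boxE; apply: measurableX; exact: measurable_itv.
  - rewrite boxE => z [/= z0]; rewrite /N /tent /= !in_itv/= => Nr.
    have {}z0 : 0 < z.2 by [].
    have h1 := ler_norm (z.1 - complex.Im l).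
    have := ler_norm (complex.Im l - z.1); rewrite distrC => h2.
    by have := a0; rewrite /I /= in_itv/=; split; lra.
apply: (le_trans (carleson (@interval_is_interval _ _))).
rewrite -/I lI poweR_EFin powRM ?(ltW r0)// -EFinM lee_fin.
by rewrite mulrA.
Qed.

(** Here [h] stands for the real or imaginary part of the resolvent applied to f. AM-GM gives |h| <=
    P N^{-2} + |f|^2 / P, and both terms have bounded integrals. *)
Lemma Rintegral_resolvent_le (f : R * R -> R[i]) (h : R * R -> R) :
  measurable_fun setT (fun z => complex.Re (f z)) ->
  measurable_fun setT (fun z => complex.Im (f z)) ->
  (\int[mu]_z (normc (f z) ^+ 2)%:E <= 1)%E -> measurable_fun setT h ->
  {ae mu, forall z, Pi_plus z ->
    h z ^+ 2 * ((a + z.2) ^+ 2 + (z.1 - complex.Im l) ^+ 2) <= normc (f z) ^+ 2} ->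
  `|\int[mu]_(z in Pi_plus) h z| <= (K + 1) * a `^ ((alpha - 1) / 2).
Proof.
move=> mfr mfi f1 mh hf.
have mPi := @measurable_Pi_plus R.
(* The weight balancing the two terms: P a^{alpha-1} and 1 / P are both a^{(alpha-1)/2}. *)
pose P := a `^ ((1 - alpha) / 2).
have P0 : 0 < P by exact: powR_gt0.
have K0 : 0 <= K.
  by have /andP[? ?] := halpha; rewrite !mulr_ge0 ?powR_ge0 ?invr_ge0 ?(ltW c0)//; lra.
have mnf : measurable_fun setT (fun z => (normc (f z) ^+ 2)%:E).
  apply/measurable_EFinP; under eq_fun do rewrite normc_sqr.
  by apply: measurable_funD; apply: measurable_funX.
have mNp : measurable_fun setT (fun z => (N z `^ (- 2))%:E).
  apply/measurable_EFinP; exact: (measurableT_comp (measurable_powR _) mN).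
have fine_le (x : \bar R) (y : R) : (`|x| <= y%:E)%E -> `|fine x| <= y.
  by case: x => //= ?; rewrite lee_fin.
apply: fine_le; apply: le_trans (le_abse_integral mu mPi _) _.
  by apply/measurable_EFinP; exact: measurable_funTS.
apply: (@le_trans _ _ (\int[mu]_(z in Pi_plus)
  (P%:E * (N z `^ (- 2))%:E + P^-1%:E * (normc (f z) ^+ 2)%:E))%E).
  apply: ae_ge0_le_integral => //.
  - apply: measurableT_comp => //; apply/measurable_EFinP; exact: measurable_funTS.
  - by move=> z _; rewrite adde_ge0// mule_ge0 ?lee_fin ?powR_ge0 ?sqr_ge0 ?invr_ge0 ?(ltW P0).
  - by apply: emeasurable_funD; apply: measurable_funeM; exact: measurable_funTS.
  apply: filterS hf => z hz Pz; have {}hz := hz Pz.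
  have {}Pz : 0 < z.2 by [].
  have N0 : 0 < N z by rewrite addr_gt0// tent_gt0.
  have -> : N z `^ (- 2) = (N z)^-1 ^+ 2 by rewrite (powR_invn 2 (ltW N0)) exprVn.
  rewrite abse_EFin -!EFinM -EFinD lee_fin.
  set F := normc (f z) ^+ 2 in hz *; have F0 : 0 <= F by exact: sqr_ge0.
  have S0 : 0 <= P * (N z)^-1 ^+ 2 + P^-1 * F.
    apply: addr_ge0; first exact: mulr_ge0 (ltW P0) (sqr_ge0 _).
    by apply: mulr_ge0 => //; rewrite invr_ge0 ltW.
  rewrite -(@ler_pXn2r _ 2)// real_normK ?num_real//.
  apply: (@le_trans _ _ (4 * (N z)^-1 ^+ 2 * F)); last first.
    rewrite -subr_ge0 (_ : _ - _ = (P * (N z)^-1 ^+ 2 - P^-1 * F) ^+ 2) ?sqr_ge0//.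
    by field; rewrite !gt_eqF.
  (* The factor 2 is the cost of the l^1 norm, N^2 <= 2 |l - iz|^2; AM-GM leaves room for a factor
     4. *)
  apply: (@le_trans _ _ (2 * (N z)^-1 ^+ 2 * F)); last first.
    by rewrite ler_wpM2r// ler_wpM2r ?sqr_ge0// ler_nat.
  apply: (@le_trans _ _ (2 * (N z)^-1 ^+ 2 *
      (h z ^+ 2 * ((a + z.2) ^+ 2 + (z.1 - complex.Im l) ^+ 2)))); last first.
    by rewrite ler_wpM2l// mulr_ge0 ?sqr_ge0.
  rewrite exprVn mulrCA -[leLHS]mulr1 ler_wpM2l ?sqr_ge0//.
  rewrite mulrAC ler_pdivlMr ?exprn_gt0// mul1r /N /tent.
  rewrite -(real_normK (num_real (z.1 - complex.Im l))) -subr_ge0.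
  rewrite (_ : _ - _ = (a + z.2 - `|z.1 - complex.Im l|) ^+ 2) ?sqr_ge0//.
  by ring.
rewrite ge0_integralD//; last 4 first.
- by move=> z _; rewrite mule_ge0 ?lee_fin ?powR_ge0 ?(ltW P0).
- by apply: measurable_funeM; exact: measurable_funTS.
- by move=> z _; rewrite mule_ge0 ?lee_fin ?sqr_ge0 ?invr_ge0 ?(ltW P0).
- by apply: measurable_funeM; exact: measurable_funTS.
rewrite !ge0_integralZl//; last 6 first.
- exact: measurable_funTS.
- by move=> z _; rewrite lee_fin sqr_ge0.
- by rewrite lee_fin invr_ge0 ltW.
- exact: measurable_funTS.
- by move=> z _; rewrite lee_fin powR_ge0.
- by rewrite lee_fin ltW.
have f1' : (\int[mu]_(z in Pi_plus) (normc (f z) ^+ 2)%:E <= 1)%E.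
  by apply: le_trans f1; apply: ge0_subset_integral => // z _; rewrite lee_fin sqr_ge0.
apply: (@le_trans _ _ (P%:E * (K * a `^ (alpha - 1))%:E + P^-1%:E * 1)%E).
  by rewrite leeD// lee_wpmul2l ?lee_fin ?invr_ge0 ?(ltW P0)//; exact: integral_resolvent_kernel.
rewrite mule1 -EFinM -EFinD lee_fin /P -powRN.
rewrite (_ : - ((1 - alpha) / 2) = (alpha - 1) / 2); last by lra.
rewrite mulrCA -powRD; last by rewrite (gt_eqF a0) implybT.
rewrite (_ : (1 - alpha) / 2 + (alpha - 1) = (alpha - 1) / 2); last by lra.
by rewrite [leRHS]mulrDl mul1r.
Qed.

Lemma dual_norm_resolvent_le :
  (dual_norm mu (functionalC mu \o resolvent mu l opA) <=
   (2 * (K + 1) * a `^ ((alpha - 1) / 2))%:E)%E.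
Proof.
apply: ge_ereal_sup => _ [f [Lf f1] <-].
have [[mgr mgi _] gf] := resolvent_opAP hmu l0 Lf.
have [mfr mfi _] := Lf.
set g := resolvent mu l opA f in mgr mgi gf *.
have f1' : (\int[mu]_z (normc (f z) ^+ 2)%:E <= 1)%E.
  rewrite -(Lnorm2_sqr mu (fun z => normc (f z))) -[leRHS]mule1 expe2.
  by apply: lee_pmul => //; exact: Lnorm_ge0.
(* Almost everywhere (l - iz) g = f, so this holds with equality, and it passes to the real and
   imaginary parts of g. *)
have gfE : {ae mu, forall z, Pi_plus z ->
    normc (g z) ^+ 2 * ((a + z.2) ^+ 2 + (z.1 - complex.Im l) ^+ 2) <= normc (f z) ^+ 2}.
  apply: filterS gf => z /(_ I) gz _; rewrite -gz subr_opA !normc_sqr.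
  rewrite le_eqVlt; apply/orP; left; apply/eqP; rewrite /a.
  by case: (l) => p q; case: (g z) => u v /=; ring.
have re_le : `|\int[mu]_(z in Pi_plus) complex.Re (g z)| <= (K + 1) * a `^ ((alpha - 1) / 2).
  apply: (Rintegral_resolvent_le mfr mfi f1' mgr).
  apply: filterS gfE => z /[apply]; apply: le_trans.
  by rewrite ler_wpM2r ?addr_ge0 ?sqr_ge0// normc_sqr lerDl sqr_ge0.
have im_le : `|\int[mu]_(z in Pi_plus) complex.Im (g z)| <= (K + 1) * a `^ ((alpha - 1) / 2).
  apply: (Rintegral_resolvent_le mfr mfi f1' mgi).
  apply: filterS gfE => z /[apply]; apply: le_trans.
  by rewrite ler_wpM2r ?addr_ge0 ?sqr_ge0// normc_sqr lerDr sqr_ge0.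
rewrite lee_fin /functionalC /cintegral /=.
apply: (@le_trans _ _ (`|\int[mu]_(z in Pi_plus) complex.Re (g z)| +
                      `|\int[mu]_(z in Pi_plus) complex.Im (g z)|)); last by lra.
rewrite -(@ler_pXn2r _ 2)// ?nnegrE ?sqrtr_ge0 ?addr_ge0//.
rewrite sqr_sqrtr ?addr_ge0 ?sqr_ge0// sqrrD !real_normK ?num_real//.
by rewrite lerD2r lerDl mulrn_wge0// mulr_ge0.
Qed.

End resolvent_bound.

Theorem theorem2p7 (R : realType) (alpha : R)
    (mu : {finite_measure set (R * R)%type -> \bar R})
    (halpha : -1 < alpha < 0)
    (hmu : mu (~` Pi_plus) = 0%E)
    (hsupp : compact (msupport mu))
    (h_i : exists2 c : R, 0 < c & forall I : set R, is_interval I ->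
       (mu (box I) <= c%:E * itv_length I `^ (1 + alpha))%E)
    (h_ii : ~ exists2 c : R, 0 < c & forall O : set R, open O ->
       (mu (open_box O) <= c%:E * riesz_capacity (- alpha / 2) O)%E) :
  ~ admissible mu alpha (functionalC mu) semigroupT /\
  (ereal_sup [set ((complex.Re l `^ ((1 - alpha) / 2))%:E *
                   dual_norm mu (functionalC mu \o resolvent mu l opA))%E
             | l in C_plus] < +oo)%E.
Proof.
split=> [adm|]; first by apply: h_ii; exact: not_admissible_of_capacity adm.
have [c c0 carleson] := h_i.
apply: (@le_lt_trans _ _
  (2 * (c * 2 `^ (1 + alpha) * 2 / (2 - (1 + alpha)) + 1))%:E); last exact: ltry.
apply: ge_ereal_sup => _ [l l0 <-].
apply: (le_trans (lee_wpmul2l _ (dual_norm_resolvent_le halpha hmu c0 carleson l0))).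
  by rewrite lee_fin powR_ge0.
have a0 : 0 < complex.Re l by exact: l0.
(* The exponents (1 - alpha) / 2 and (alpha - 1) / 2 cancel, leaving a bound independent of l. *)
rewrite -EFinM lee_fin mulrCA -powRD; last by rewrite (gt_eqF a0) implybT.
by rewrite -mulrDl addrA subrK subrr mul0r powRr0 mulr1.
Qed.
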